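(* Let $P\subset\mathbb{R}^d$ be finite and let $\mathbf{d}_N$ be the nearest neighbor metric with respect to $P$. The edges of the intrinsic Čech filtration with respect to $\mathbf{d}_N$ can be computed exactly in polynomial time.
   Context: $\|\cdot\|$ is the Euclidean norm. The nearest neighbor metric with respect to $P$ is $$\mathbf{d}_N(a,b)=\inf_{\gamma}\int_0^1 4\Big(\min_{x\in P}\|x-\gamma(t)\|\Big)\|\gamma'(t)\|\,dt ,$$ the infimum being over all piecewise-$C^1$ continuous paths $\gamma:[0,1]\to\mathbb{R}^d$ from $a$ to $b$. The intrinsic Čech filtration with respect to $\mathbf{d}_N$ is the family of complexes, indexed by scales $\alpha\ge 0$, defined by intersections of metric balls: the vertex set is the input point set $P$; the edges at scale $\alpha$ are the pairs of points of $P$ whose $\alpha$-radius balls $\{x\in\mathbb{R}^d:\mathbf{d}_N(x,p)\le\alpha\}$ intersect; triangles correspond to three-way intersections of such balls, tetrahedra to four-way intersections, and so on. *)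

(* Defs.v *)
From HB Require Import structures.
From mathcomp Require Import all_boot all_order all_algebra finmap.
From mathcomp Require Import all_classical all_reals all_analysis.

Set Implicit Arguments.
Unset Strict Implicit.
Unset Printing Implicit Defensive.

Import Order.TTheory GRing.Theory Num.Theory.
Import numFieldNormedType.Exports.

Local Open Scope classical_set_scope.
Local Open Scope fset_scope.
Local Open Scope ring_scope.

Section NearestNeighborMetric.
Context (R : realType) (d : nat).
Implicit Types (P : {fset 'rV[R]_d}) (g v : R -> 'rV[R]_d) (x y : 'rV[R]_d).

(* The library norm on 'rV[R]_d is the sup norm; it is only used below through
   the topology it induces (continuity and derivatives of paths). *)
Definition enorm x : R := Num.sqrt (\sum_(i < d) x 0 i ^+ 2).

(* The default value of the iterated minimum is one of its own terms, so for
   nonempty P this is the minimum over P; for empty P it is a dummy value. *)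
Definition nn_dist P y : R :=
  \big[Num.min/enorm (head 0 P - y)]_(x <- P) enorm (x - y).

(* C^1 on the closed interval [a, b], with one-sided derivatives at a and b:
   given the continuity of g on [a, b], this amounts to g' existing on ]a, b[
   and extending continuously to [a, b]. *)
Definition C1_on (a b : R) g : Prop :=
  {within `[a, b], continuous g} /\
  exists2 v, {within `[a, b], continuous v} &
    forall t, t \in `]a, b[ -> is_derive t 1 g (v t).

Definition piecewise_C1_path x y g : Prop :=
  [/\ {within `[0, 1], continuous g}, g 0 = x, g 1 = y &
      exists2 s : seq R, itv_partition 0 1 s &
        forall i, (i < size s)%N -> C1_on (nth 0 (0 :: s) i) (nth 0 s i) g].

(* At the finitely many breakpoints derive1 g is unspecified; they form a null set
   for the Lebesgue measure. *)
Definition nn_length P g : \bar R :=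
  \int[lebesgue_measure]_(t in `[0, 1]) (4 * nn_dist P (g t) * enorm (derive1 g t))%:E.

Definition nn_metric P x y : \bar R :=
  ereal_inf [set nn_length P g | g in piecewise_C1_path x y].

End NearestNeighborMetric.

Section CechFiltration.
Context (R : realType) (X : choiceType).
Implicit Types (dist : X -> X -> \bar R) (P : {fset X}).

Definition metric_ball dist (p : X) (alpha : R) : set X :=
  [set x | (dist x p <= alpha%:E)%E].

Definition cech dist P (alpha : R) : set {fset X} :=
  [set sigma : {fset X} | [/\ sigma != fset0, fsubset sigma P &
    \bigcap_(p in [set` sigma]) metric_ball dist p alpha !=set0]].

Definition cech_edges dist P (alpha : R) : set {fset X} :=
  [set e | cech dist P alpha e /\ #|` e| = 2%N].

End CechFiltration.

(* Real RAM.  A machine has natural-number index registers and an unbounded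
   memory of exact real numbers, addressed indirectly through the registers.
   Real cells support the four arithmetic operations and comparison, and there
   is no rounding operation.  Index registers support only addition and
   truncated subtraction: unit-cost multiplication of integers would not be a
   realistic cost.  Programs are finite texts containing no real constants, and
   they do not depend on the size of the input. *)

Inductive index_instr : Type :=
| IConst of nat
| IAdd of nat & nat
| ISub of nat & nat.

Inductive real_instr : Type :=
| RConst of nat
| RAdd of nat & nat
| RSub of nat & nat
| RMul of nat & nat
| RDiv of nat & nat.

Inductive test : Type :=
| TIndexLt of nat & nat
| TRealLt of nat & nat.

Inductive program : Type :=
| SetIndex of nat & index_instr
| SetReal of nat & real_instr
| Seq of program & program
| If of test & program & program
| While of test & program.

Section RealRAM.
Context (R : realType).

Record state := State { reg : nat -> nat; mem : nat -> R }.

Definition update (T : Type) (f : nat -> T) (a : nat) (v : T) : nat -> T :=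
  fun b => if b == a then v else f b.

Definition index_value (st : state) (i : index_instr) : nat :=
  match i with
  | IConst k => k
  | IAdd a b => (reg st a + reg st b)%N
  | ISub a b => (reg st a - reg st b)%N
  end.

Definition cell (st : state) (a : nat) : R := mem st (reg st a).

Definition real_value (st : state) (i : real_instr) : R :=
  match i with
  | RConst k => k%:R
  | RAdd a b => cell st a + cell st b
  | RSub a b => cell st a - cell st b
  | RMul a b => cell st a * cell st b
  | RDiv a b => cell st a / cell st b
  end.

Definition test_value (st : state) (t : test) : bool :=
  match t with
  | TIndexLt a b => (reg st a < reg st b)%N
  | TRealLt a b => cell st a < cell st b
  end.

(* [exec c st T st']: started in st, the program c halts in st' after exactly T
   steps, each instruction and each evaluation of a test being one step. *)
Inductive exec : program -> state -> nat -> state -> Prop :=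
| exec_index r i st :
    exec (SetIndex r i) st 1
         (State (update (reg st) r (index_value st i)) (mem st))
| exec_real r i st :
    exec (SetReal r i) st 1
         (State (reg st) (update (mem st) (reg st r) (real_value st i)))
| exec_seq c1 c2 st1 st2 st3 T1 T2 :
    exec c1 st1 T1 st2 -> exec c2 st2 T2 st3 ->
    exec (Seq c1 c2) st1 (T1 + T2) st3
| exec_if t c1 c2 st st' T :
    exec (if test_value st t then c1 else c2) st T st' ->
    exec (If t c1 c2) st T.+1 st'
| exec_while_stop t c st :
    ~~ test_value st t -> exec (While t c) st 1 st
| exec_while_step t c st1 st2 st3 T1 T2 :
    test_value st1 t -> exec c st1 T1 st2 -> exec (While t c) st2 T2 st3 ->
    exec (While t c) st1 (T1 + T2).+1 st3.

(* Registers 0 and 1 hold the number of points and the dimension; coordinate k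
   of the i-th point is in cell i * d + k; everything else is 0. *)
Definition input_state (d : nat) (s : seq 'rV[R]_d) : state :=
  State (fun r => nth 0%N [:: size s; d] r)
        (fun a => nth 0 [seq p 0 k | p : 'rV[R]_d <- s, k <- enum 'I_d] a).

End RealRAM.

(* The family of edge sets over all scales alpha >= 0 is represented by the
   scale at which each edge enters: cell i * n + j, for i < j < n, holds the
   threshold for the edge between the i-th and the j-th of the n points of s. *)
Definition encodes_cech_edges (R : realType) (d : nat)
    (dist : 'rV[R]_d -> 'rV[R]_d -> \bar R) (P : {fset 'rV[R]_d})
    (s : seq 'rV[R]_d) (st : state R) : Prop :=
  forall i j : nat, (i < j < size s)%N ->
  forall alpha : R, 0 <= alpha ->
    cech_edges dist P alpha [fset nth 0 s i; nth 0 s j] <->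
    mem st (i * size s + j)%N <= alpha.

(* Main.v *)
Require Import Defs.
From HB Require Import structures.
From mathcomp Require Import all_boot all_order all_algebra finmap.
From mathcomp Require Import all_classical all_reals all_analysis.
From mathcomp Require Import measurable_realfun zify ring lra.

(** The nearest neighbor metric d_N agrees on P with the edge-squared metric D,
    the shortest-path metric of the complete graph on P whose edge pq has weight
    |p - q|^2.  The upper bound is the cost of straight segments.  For the lower
    bound, f = D(a, .) satisfies |f p - f q| <= |p - q|^2, so composing f with a
    curve c such that |c s - c t|^2 = |s - t| (for the finitely many values of f,
    the vertices of a monotone path along the edges of a box) gives a
    1-Lipschitz map from P to a Euclidean space.  By Kirszbraun's theorem it
    extends 1-Lipschitz to any further points.  On the box, the sum over the
    coordinates of the one-dimensional potentials with derivative
    4 min (t, l - t) has gradient at most 4 times the distance to every vertex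
    of the box, and it inverts c.  Pulling it back bounds D by the length of
    every path.

    Concatenating a path into a ball centre with one out of it, the balls of
    radius alpha around a and b meet only if D(a, b) <= 2 alpha; conversely the
    point halfway along a shortest path lies in both.  Thus the edge ab enters
    at scale D(a, b) / 2, and all these thresholds come from Floyd-Warshall. *)

Set Implicit Arguments.
Unset Strict Implicit.
Unset Printing Implicit Defensive.

Import Order.TTheory GRing.Theory Num.Theory.
Import numFieldNormedType.Exports.
Local Open Scope ring_scope.

(* After the MathComp imports, [mem] is the membership predicate. *)
Local Notation memory := Defs.mem.

(** * Shortest paths on the real RAM *)

Fixpoint writes (c : program) : seq nat :=
  match c with
  | SetIndex r _ => [:: r]
  | SetReal _ _ => [::]
  | Seq c1 c2 => writes c1 ++ writes c2
  | If _ c1 c2 => writes c1 ++ writes c2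
  | While _ c => writes c
  end.

(** * Time-bounded reasoning about programs *)

Section RAM.
Context (R : realType).
Implicit Types (st : state R) (c : program) (Q : state R -> Prop).

Lemma exec_frame c st T st' : exec c st T st' ->
  forall r, r \notin writes c -> reg st' r = reg st r.
Proof.
elim=> {c st T st'}.
- by move=> r i st r'; rewrite inE /= /update => /negbTE ->.
- by [].
- move=> c1 c2 st1 st2 st3 T1 T2 _ IH1 _ IH2 r /=.
  by rewrite mem_cat negb_or => /andP[r1 r2]; rewrite IH2 // IH1.
- move=> t c1 c2 st st' T _ IH r /=.
  by rewrite mem_cat negb_or => /andP[r1 r2]; apply: IH; case: ifP.
- by [].
- by move=> t c st1 st2 st3 T1 T2 _ _ IH1 _ IH2 r rc; rewrite IH2 // IH1.
Qed.

Definition runs c st (t : nat) Q :=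
  exists T st', [/\ exec c st T st', (T <= t)%N & Q st'].

Lemma runs_weaken c st t t' Q Q' : runs c st t Q -> (t <= t')%N ->
  (forall st', Q st' -> Q' st') -> runs c st t' Q'.
Proof.
move=> [T [st' [e le q]]] tt' QQ'; exists T, st'; split=> //.
  exact: leq_trans le tt'.
exact: QQ'.
Qed.

Lemma runs_frame c st t Q : runs c st t Q ->
  runs c st t (fun st' => Q st' /\
    forall r, r \notin writes c -> reg st' r = reg st r).
Proof.
move=> [T [st' [e le q]]]; exists T, st'; split=> //; split=> //.
exact: exec_frame e.
Qed.

Lemma runs_index r i st Q :
  Q (State (update (reg st) r (index_value st i)) (memory st)) ->
  runs (SetIndex r i) st 1 Q.
Proof. by move=> q; exists 1%N; eexists; split; [exact: exec_index| |]. Qed.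

Lemma runs_real r i st Q :
  Q (State (reg st) (update (memory st) (reg st r) (real_value st i))) ->
  runs (SetReal r i) st 1 Q.
Proof. by move=> q; exists 1%N; eexists; split; [exact: exec_real| |]. Qed.

Lemma runs_seq c1 c2 st t1 t2 Q :
  runs c1 st t1 (fun st1 => runs c2 st1 t2 Q) -> runs (Seq c1 c2) st (t1 + t2) Q.
Proof.
move=> [T1 [st1 [e1 le1 [T2 [st2 [e2 le2 q]]]]]].
exists (T1 + T2)%N, st2; split=> //; first exact: exec_seq e1 e2.
exact: leq_add.
Qed.

Lemma runs_if b c1 c2 st t Q :
  runs (if test_value st b then c1 else c2) st t Q -> runs (If b c1 c2) st t.+1 Q.
Proof. by move=> [T [st' [e le q]]]; exists T.+1, st'; split=> //; exact: exec_if. Qed.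

(* Register 2 permanently holds the constant 1. *)
Definition For (i b : nat) (c : program) : program :=
  Seq (SetIndex i (IConst 0))
      (While (TIndexLt i b) (Seq c (SetIndex i (IAdd i 2)))).

(** The counter is reset and incremented outside [c], so [Inv] has to survive any change of register
    [i]. Each round pays for one test and one increment; the leading 2 pays for the initialisation
    and the last test. *)
Lemma runs_for i b c (Inv : nat -> state R -> Prop) m t st0 :
  b != i -> 2%N != i -> b \notin writes c -> 2%N \notin writes c ->
  i \notin writes c -> reg st0 b = m -> reg st0 2 = 1%N ->
  (forall k st v, Inv k st -> Inv k (State (update (reg st) i v) (memory st))) ->
  Inv 0%N st0 ->
  (forall k st, (k < m)%N -> reg st i = k ->
     (forall r, r \notin i :: writes c -> reg st r = reg st0 r) -> Inv k st ->
     runs c st t (Inv k.+1)) ->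
  runs (For i b c) st0 (2 + m * (t + 2)) (Inv m).
Proof.
move=> bi ei bc ec ic b0 e0 Iupd I0 step.
have loop : forall l k st, (k + l = m)%N -> reg st i = k ->
    (forall r, r \notin i :: writes c -> reg st r = reg st0 r) -> Inv k st ->
    runs (While (TIndexLt i b) (Seq c (SetIndex i (IAdd i 2)))) st
      (1 + l * (t + 2)) (Inv m).
  elim=> [|l IH] k st klm sti sfr Ik.
    exists 1%N, st; split=> //; last by rewrite -klm addn0.
    apply: exec_while_stop; rewrite /= sti sfr ?b0 -?klm ?addn0 ?ltnn //.
    by rewrite inE negb_or bi.
  have km : (k < m)%N by rewrite -klm -addSnnS leq_addr.
  have [T1 [st1 [e1 le1 [I1 fr1]]]] := runs_frame (step k st km sti sfr Ik).
  pose st2 := State (update (reg st1) i (reg st1 i + reg st1 2)%N) (memory st1).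
  have [||||T2 [st3 [e2 le2 I3]]] := IH k.+1 st2.
  - by rewrite addSnnS.
  - rewrite /st2 /= /update eqxx fr1 // sti fr1 // sfr ?e0 ?addn1 //.
    by rewrite inE negb_or ei.
  - move=> r rr; have := rr; rewrite inE negb_or => /andP[ri rc].
    by rewrite /st2 /= /update (negbTE ri) fr1 // sfr.
  - exact: (Iupd _ st1).
  exists (T1 + 1 + T2).+1, st3; split=> //.
    apply: exec_while_step e2.
      by rewrite /= sti sfr ?b0 // inE negb_or bi.
    by apply: exec_seq e1 _; exact: exec_index.
  by rewrite mulSn; lia.
rewrite (_ : 2 + _ = 1 + (1 + m * (t + 2)))%N; last by lia.
apply: runs_seq; apply: runs_index => /=.
apply: (loop m 0%N) => //=; first by rewrite /update eqxx.
  by move=> r; rewrite inE negb_or /update => /andP[/negbTE ->].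
exact: Iupd.
Qed.

(* Register 7 is the counter. *)
Definition Addr (r base i b j : nat) : program :=
  Seq (SetIndex r (IAdd base j)) (For 7 i (SetIndex r (IAdd r b))).

(** Index registers cannot be multiplied, so the product is formed by repeated addition, in time
    linear in register [i]. *)
Lemma runs_addr r base i b j st :
  r \notin [:: 2; 7; i; b]%N -> 7%N \notin [:: i; b] -> reg st 2 = 1%N ->
  runs (Addr r base i b j) st (3 + reg st i * 3)
   (fun st' => reg st' r = (reg st base + (reg st i * reg st b + reg st j))%N /\
      memory st' = memory st).
Proof.
rewrite !inE !negb_or => /and4P[r2 r7 ri rb] /andP[i7 b7] one.
rewrite -[3%N]/(1 + 2)%N -addnA; apply: runs_seq; apply: runs_index.
rewrite /=; set st1 := State _ _.
have i1 : reg st1 i = reg st i by rewrite /= /update eq_sym (negbTE ri).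
have b1 : reg st1 b = reg st b by rewrite /= /update eq_sym (negbTE rb).
pose Inv k st' := reg st' r = (reg st base + (k * reg st b + reg st j))%N /\
  memory st' = memory st.
apply: (@runs_weaken _ _ (2 + reg st i * (1 + 2)) _ (Inv (reg st i))) => //.
apply: (@runs_for 7 i (SetIndex r (IAdd r b)) Inv) => //=.
- by rewrite eq_sym.
- by rewrite inE eq_sym.
- by rewrite inE eq_sym.
- by rewrite inE eq_sym.
- by rewrite /update [2%N == _]eq_sym (negbTE r2).
- by move=> k st' v [h1 h2]; split=> //=; rewrite /update (negbTE r7).
- by rewrite /Inv /st1 /= /update eqxx; split=> //; lia.
- move=> k st' ki st'7 fr [h1 h2]; apply: runs_index; split=> //=.
  rewrite [LHS]/update eqxx h1 fr; first by move: b1; rewrite /= => ->; rewrite mulSn; lia.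
  by rewrite !inE negb_or eq_sym b7 eq_sym.
Qed.

Lemma runs_addr_seq r base i b j c N t st Q :
  r \notin [:: 2; 7; i; b]%N -> 7%N \notin [:: i; b] -> reg st 2 = 1%N ->
  (reg st i <= N)%N ->
  (forall st', reg st' r = (reg st base + (reg st i * reg st b + reg st j))%N ->
     memory st' = memory st ->
     (forall r', r' \notin [:: r; 7%N] -> reg st' r' = reg st r') ->
     runs c st' t Q) ->
  runs (Seq (Addr r base i b j) c) st (3 + N * 3 + t) Q.
Proof.
move=> h1 h2 h3 iN H; apply: runs_seq.
apply: runs_weaken (runs_frame (runs_addr base j h1 h2 h3)) _ _; first by lia.
move=> st' [[e1 e2] fr]; apply: H => // r' r'r; apply: fr.
by move: r'r; rewrite /= !inE; case: (r' == r); case: (r' == 7%N).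
Qed.

(** * Loops over all pairs of indices *)

Section Grid.
Variables (n : nat) (tmp base : nat) (V : nat -> R).

(** Pairs are visited in row-major order, so before round [(i, j)] exactly the first [i * n + j]
    cells from [base] carry their final value. The body may rely on this mixture, as an in-place
    update must; the scratch cell [tmp] is exempt. *)
Lemma runs_for2 c t st0 :
  reg st0 0 = n -> reg st0 2 = 1%N ->
  [/\ 0%N \notin writes c, 2%N \notin writes c, 8%N \notin writes c &
      9%N \notin writes c] ->
  (forall i j st, (i < n)%N -> (j < n)%N -> reg st 8 = i -> reg st 9 = j ->
    (forall r, r \notin [:: 8, 9 & writes c]%N -> reg st r = reg st0 r) ->
    (forall a, a != tmp -> memory st a =
       if (base <= a < base + (i * n + j))%N then V (a - base)%N
       else memory st0 a) ->
    runs c st t (fun st' => forall a, a != tmp -> memory st' a =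
       if a == (base + (i * n + j))%N then V (i * n + j)%N else memory st a)) ->
  runs (For 8 0 (For 9 0 c)) st0 (2 + n * (2 + n * (t + 2) + 2))
    (fun st' => forall a, a != tmp -> memory st' a =
       if (base <= a < base + n * n)%N then V (a - base)%N else memory st0 a).
Proof.
move=> n0 one0 [c0 c2 c8 c9] body.
pose Inv k st := forall a, a != tmp -> memory st a =
  if (base <= a < base + k)%N then V (a - base)%N else memory st0 a.
apply: (@runs_for 8 0 (For 9 0 c) (fun k => Inv (k * n)%N)) => //.
- by rewrite /= inE mem_cat inE (negbTE c0).
- by rewrite /= inE mem_cat inE (negbTE c2).
- by rewrite /= inE mem_cat inE (negbTE c8).
- by move=> a _; rewrite mul0n addn0; case: ifP => //; lia.
move=> i st1 ilt st1i fr1 I1.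
have fr1' r : r \notin [:: 8, 9 & writes c]%N -> reg st1 r = reg st0 r.
  move=> rr; apply: fr1; move: rr; rewrite /= !inE mem_cat inE.
  by case: (r == 8%N); case: (r == 9%N); case: (r \in writes c).
have -> : (i.+1 * n = i * n + n)%N by rewrite mulSn addnC.
apply: (@runs_for 9 0 c (fun k => Inv (i * n + k)%N)) => //.
- by rewrite fr1' //= !inE.
- by rewrite fr1' //= !inE.
- by rewrite addn0.
move=> j st2 jlt st2j fr2 I2.
have fr2' r : r \notin [:: 8, 9 & writes c]%N -> reg st2 r = reg st0 r.
  move=> rr; rewrite fr2 ?fr1' //; move: rr; rewrite !inE.
  by case: (r == 8%N); case: (r == 9%N); case: (r \in writes c).
apply: runs_weaken (body i j st2 ilt jlt _ st2j fr2' I2) (leqnn _) _.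
  by rewrite fr2 // !inE.
move=> st' H a atmp; rewrite H //; case: eqP => [->|na].
  by rewrite addKn; case: ifP => //; lia.
rewrite I2 //; congr (if _ then _ else _); lia.
Qed.

End Grid.

(** Registers 3, 4 and 5 hold the addresses of a scratch cell, of the constant 2 and of the working
    matrix, and register 6 holds 0. Registers 8, 9 and 10 are loop counters, 11 to 13 hold
    addresses. *)
Definition prog_dist : program :=
  Seq (Addr 11 5 8 0 9) (Seq (SetReal 11 (RConst 0))
  (For 10 1 (Seq (Addr 12 6 8 1 10) (Seq (Addr 13 6 9 1 10)
    (Seq (SetReal 3 (RSub 12 13)) (Seq (SetReal 3 (RMul 3 3))
         (SetReal 11 (RAdd 11 3)))))))).

(** The matrix is relaxed in place. There is no empty instruction, so the other branch writes to
    register 14, which is idle by then. *)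
Definition prog_relax : program :=
  Seq (Addr 11 5 8 0 9) (Seq (Addr 12 5 8 0 10) (Seq (Addr 13 5 10 0 9)
  (Seq (SetReal 3 (RAdd 12 13))
  (If (TRealLt 3 11) (SetReal 11 (RAdd 12 13)) (SetIndex 14 (IConst 0)))))).

(** The output overwrites the input from cell 0 on; scratch cell, constant and working matrix lie
    beyond both. *)
Definition prog_half : program :=
  Seq (Addr 11 5 8 0 9) (Seq (Addr 12 6 8 0 9) (SetReal 12 (RDiv 11 4))).

Definition prog_init (c : program) : program :=
  Seq (SetIndex 2 (IConst 1)) (Seq (Addr 3 6 0 0 6) (Seq (Addr 14 6 0 1 6)
  (Seq (SetIndex 3 (IAdd 3 14)) (Seq (SetIndex 4 (IAdd 3 2))
  (Seq (SetIndex 5 (IAdd 4 2)) (Seq (SetReal 4 (RConst 2)) c)))))).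

Definition prog_edges : program :=
  prog_init (Seq (For 8 0 (For 9 0 prog_dist))
            (Seq (For 10 0 (For 8 0 (For 9 0 prog_relax)))
                 (For 8 0 (For 9 0 prog_half)))).

(** The Floyd-Warshall recursion, with [k] bounding the intermediate vertices. *)
Fixpoint fw (w : nat -> nat -> R) (k i j : nat) : R :=
  if k is l.+1 then Num.min (fw w l i l + fw w l l j) (fw w l i j) else w i j.

(** * Correctness and running time *)

Section Correct.
Variables (n d : nat).
Local Notation T0 := (n * n + n * d)%N.
Local Notation N := (n + d)%N.

Definition env st := [/\ reg st 0 = n, reg st 1 = d, reg st 2 = 1%N & reg st 6 = 0%N]
  /\ [/\ reg st 3 = T0, reg st 4 = T0.+1 & reg st 5 = T0.+2].

Lemma env_frame (l : seq nat) st st' : env st -> all (fun r => r \notin l) [:: 0; 1; 2; 6; 3;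
  4; 5]%N ->
  (forall r, r \notin l -> reg st' r = reg st r) -> env st'.
Proof.
move=> [[e0 e1 e2 e6] [e3 e4 e5]] /= /and5P[l0 l1 l2 l6 /and4P[l3 l4 l5 _]] fr.
by split; split; rewrite fr.
Qed.

Lemma runs_dist (x : nat -> nat -> R) st0 : env st0 ->
  (forall i k, (i < n)%N -> (k < d)%N -> memory st0 (i * d + k)%N = x i k) ->
  runs (For 8 0 (For 9 0 prog_dist)) st0
    (2 + n * (2 + n * (3 + N * 3 + (1 + (2 + d * (3 + N * 3 + (3 + N * 3 + 3) + 2))) + 2) + 2))
    (fun st' => forall a, a != T0 -> memory st' a =
       if (T0.+2 <= a < T0.+2 + n * n)%N
       then \sum_(k < d) (x ((a - T0.+2) %/ n)%N k - x ((a - T0.+2) %% n)%N k) ^+ 2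
       else memory st0 a).
Proof.
move=> env0 x0; have [[e0 e1 e2 e6] [e3 e4 e5]] := env0.
pose V e : R := \sum_(k < d) (x (e %/ n)%N k - x (e %% n)%N k) ^+ 2.
apply: (@runs_for2 n T0 T0.+2 V) => // i j st ilt jlt sti stj fr memst.
have [[r0 r1 r2 r6] [r3 r4 r5]] : env st by apply: env_frame env0 _ fr.
apply: runs_addr_seq => //; first by rewrite sti; lia.
move=> st1 a1 m1 fr1; move: a1; rewrite r5 r0 sti stj => a1.
apply: runs_seq; apply: runs_real; rewrite a1 /= m1.
set st2 := State _ _.
pose A := (T0.+2 + (i * n + j))%N.
pose Inv k st' := forall a, a != T0 -> memory st' a =
  if a == A then \sum_(l < k) (x i l - x j l) ^+ 2 else memory st a.
apply: (@runs_weaken _ _ (2 + d * (3 + N * 3 + (3 + N * 3 + 3) + 2)) _ (Inv d)) => //;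
  last first.
  move=> st' I a aT; rewrite I //; case: ifP => // _.
  by rewrite /V divnMDl ?modnMDl ?divn_small ?modn_small ?addn0 //; lia.
apply: (@runs_for 10 1 _ Inv) => //.
- by rewrite /= fr1 // r1.
- by rewrite /= fr1 // r2.
- by move=> a aT; rewrite big_ord0 /st2 /= /update.
move=> k st3 klt st3k fr3 I3.
have fr3' r : r \notin [:: 10; 12; 13; 7; 11]%N -> reg st3 r = reg st r.
  move=> rr; rewrite fr3 ?fr1 //; move: rr; rewrite /= !inE.
    by case: (r == 11) (r == 7) => [] [] //; rewrite !orbT.
  by case: (r == 10%N) (r == 12%N) (r == 13%N) (r == 7%N) => [] [] [] [].
have x3 l : (l < n)%N -> memory st3 (l * d + k)%N = x l k.
  move=> ln; have lt : (l * d + k < T0)%N.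
    by have := leq_mul ln (leqnn d); rewrite mulSn; lia.
  rewrite I3 ?ifF ?memst ?ifF ?x0 //; try (rewrite /A; lia).
apply: runs_addr_seq => //; first by rewrite fr3' // r2.
  by rewrite fr3' // sti; lia.
move=> st4 a4 m4 fr4.
move: a4; rewrite st3k !fr3' // r6 sti r1 add0n => a4.
apply: runs_addr_seq => //; first by rewrite fr4 // fr3' // r2.
  by rewrite fr4 // fr3' // stj; lia.
move=> st5 a5 m5 fr5.
move: a5; rewrite (fr4 10%N) // st3k !fr4 // !fr3' // r6 stj r1 add0n => a5.
have s11 : reg st5 11 = A by rewrite fr5 // fr4 // fr3 //= a1.
have s12 : reg st5 12 = (i * d + k)%N by rewrite fr5 // a4.
have s3 : reg st5 3 = T0 by rewrite fr5 // fr4 // fr3' // r3.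
rewrite -[3%N in X in runs _ _ X]/(1 + (1 + 1))%N.
apply: runs_seq; apply: runs_real; apply: runs_seq; apply: runs_real.
apply: runs_real => a aT.
have AT : A != T0 by rewrite /A; lia.
rewrite /= /cell /= /update s3 s11 s12 a5 m5 m4.
have [_|aA] := eqVneq a A.
  by rewrite ?eqxx (negbTE AT) I3 // eqxx big_ord_recr /= x3 // x3.
by rewrite !(negbTE aT) I3 // (negbTE aA).
Qed.

(** Updating in place is harmless because the diagonal vanishes: round [k] leaves row [k] and column
    [k] unchanged, so it does not matter whether their entries are read before or after their own
    update. *)
Lemma runs_relax (w : nat -> nat -> R) st0 : env st0 ->
  (forall k, (k < n)%N -> fw w k k k = 0) ->
  (forall a, (T0.+2 <= a < T0.+2 + n * n)%N ->
     memory st0 a = w ((a - T0.+2) %/ n)%N ((a - T0.+2) %% n)%N) ->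
  runs (For 10 0 (For 8 0 (For 9 0 prog_relax))) st0
    (2 + n * (2 + n * (2 + n * (3 + N * 3 + (3 + N * 3 + (3 + N * 3 + 3)) + 2) + 2) + 2))
    (fun st' => forall a, a != T0 -> memory st' a =
       if (T0.+2 <= a < T0.+2 + n * n)%N
       then fw w n ((a - T0.+2) %/ n)%N ((a - T0.+2) %% n)%N
       else memory st0 a).
Proof.
move=> env0 w0 m0; have [[e0 e1 e2 e6] [e3 e4 e5]] := env0.
pose V k e : R := fw w k (e %/ n)%N (e %% n)%N.
pose Inv k st := forall a, a != T0 -> memory st a =
  if (T0.+2 <= a < T0.+2 + n * n)%N then V k (a - T0.+2)%N else memory st0 a.
apply: (@runs_for 10 0 _ Inv) => //.
  by move=> a aT; case: ifP => // /m0 ->.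
move=> k st klt stk fr Ik.
have env1 : env st by apply: env_frame env0 _ fr.
apply: runs_weaken.
- apply: (@runs_for2 n T0 T0.+2 (V k.+1) prog_relax
    (3 + N * 3 + (3 + N * 3 + (3 + N * 3 + 3)))) => //.
  + by case: env1 => [[]].
  + by case: env1 => [[]].
  move=> i j st1 ilt jlt st1i st1j fr1 m1.
  have [[r0 r1 r2 r6] [r3 r4 r5]] : env st1 by apply: env_frame env1 _ fr1.
  have st1k : reg st1 10 = k by rewrite fr1.
  have Vij a b : (b < n)%N -> forall l, V l (a * n + b)%N = fw w l a b.
    move=> bn l; rewrite /V divnMDl ?modnMDl ?divn_small ?modn_small ?addn0 //.
    by lia.
  have M a b : (a < n)%N -> (b < n)%N -> memory st1 (T0.+2 + (a * n + b))%N =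
      if (a * n + b < i * n + j)%N then fw w k.+1 a b else fw w k a b.
    move=> an bn; have ab : (a * n + b < n * n)%N.
      by have := leq_mul an (leqnn n); rewrite mulSn; lia.
    rewrite m1 ?leq_addr ?ltn_add2l ?addKn ?Vij //=; last by lia.
    by case: ifP => // _; rewrite Ik ?ifT ?addKn ?Vij //; lia.
  have Mij : memory st1 (T0.+2 + (i * n + j))%N = fw w k i j.
    by rewrite M // ltnn.
  have Mik : memory st1 (T0.+2 + (i * n + k))%N = fw w k i k.
    by rewrite M // /= w0 // addr0 minxx; case: ifP.
  have Mkj : memory st1 (T0.+2 + (k * n + j))%N = fw w k k j.
    by rewrite M // /= w0 // add0r minxx; case: ifP.
  apply: runs_addr_seq => //; first by rewrite st1i; lia.
  move=> st2 a2 m2 fr2; move: a2; rewrite r5 r0 st1i st1j => a2.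
  apply: runs_addr_seq => //; first by rewrite fr2.
    by rewrite fr2 // st1i; lia.
  move=> st3 a3 m3 fr3; move: a3; rewrite !fr2 // r5 r0 st1i st1k => a3.
  apply: runs_addr_seq => //; first by rewrite fr3 // fr2.
    by rewrite fr3 // fr2 // st1k; lia.
  move=> st4 a4 m4 fr4; move: a4; rewrite !fr3 // !fr2 // r5 r0 st1j st1k => a4.
  have s11 : reg st4 11 = (T0.+2 + (i * n + j))%N by rewrite fr4 // fr3.
  have s12 : reg st4 12 = (T0.+2 + (i * n + k))%N by rewrite fr4.
  have s3 : reg st4 3 = T0 by rewrite fr4 // fr3 // fr2.
  have mm : memory st4 = memory st1 by rewrite m4 m3 m2.
  have nT e : (T0.+2 + e)%N != T0 by lia.
  rewrite -[3%N in X in runs _ _ X]/(1 + 2)%N.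
  apply: runs_seq; apply: runs_real.
  rewrite /= /cell s3 s12 a4 mm Mik Mkj.
  apply: runs_if; rewrite /= /cell /= /update s3 s11 eqxx (negbTE (nT _)) Mij.
  rewrite Vij //=; case: ltP => lt.
    apply: runs_real => a aT; rewrite /= /cell /= /update s11 s12 a4.
    rewrite !(negbTE (nT _)) (negbTE aT) Mik Mkj.
    by case: eqP.
  apply: runs_index => a aT; rewrite /= /update (negbTE aT).
  by case: eqP => // ->; rewrite Mij.
- exact: leqnn.
- move=> st' H a aT; rewrite H // Ik //; by case: (_ < a < _)%N.
Qed.

Lemma runs_half st0 : env st0 -> memory st0 T0.+1 = 2%:R ->
  runs (For 8 0 (For 9 0 prog_half)) st0
    (2 + n * (2 + n * (3 + N * 3 + (3 + N * 3 + 1) + 2) + 2))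
    (fun st' => forall a, (a < n * n)%N ->
       memory st' a = memory st0 (T0.+2 + a)%N / 2).
Proof.
move=> env0 two; have [[e0 e1 e2 e6] [e3 e4 e5]] := env0.
apply: runs_weaken.
- apply: (@runs_for2 n T0 0 (fun e => memory st0 (T0.+2 + e)%N / 2) prog_half
    (3 + N * 3 + (3 + N * 3 + 1))) => //.
  move=> i j st1 ilt jlt st1i st1j fr1 m1.
  have [[r0 r1 r2 r6] [r3 r4 r5]] : env st1 by apply: env_frame env0 _ fr1.
  have ij : (i * n + j < n * n)%N.
    by have := leq_mul ilt (leqnn n); rewrite mulSn; lia.
  apply: runs_addr_seq => //; first by rewrite st1i; lia.
  move=> st2 a2 m2 fr2; move: a2; rewrite r5 r0 st1i st1j => a2.
  apply: runs_addr_seq => //; first by rewrite fr2.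
    by rewrite fr2 // st1i; lia.
  move=> st3 a3 m3 fr3; move: a3; rewrite !fr2 // r6 r0 st1i st1j => a3.
  apply: runs_real => a aT; rewrite /= /cell /update a3 m3 m2.
  case: eqP => // _; rewrite fr3 // a2 fr3 // fr2 // r4.
  rewrite !m1 ?ifF ?two //; lia.
- exact: leqnn.
- by move=> st' H a an; rewrite H ?ifT ?subn0 //; lia.
Qed.

Lemma runs_init c t st0 Q : reg st0 0 = n -> reg st0 1 = d -> reg st0 6 = 0%N ->
  (forall st, env st -> memory st T0.+1 = 2%:R ->
     (forall a, (a < n * d)%N -> memory st a = memory st0 a) -> runs c st t Q) ->
  runs (prog_init c) st0 (1 + (3 + N * 3 + (3 + N * 3 + (1 + (1 + (1 + (1 + t))))))) Q.
Proof.
move=> e0 e1 e6 H; apply: runs_seq; apply: runs_index.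
apply: runs_addr_seq => //=; first by rewrite /update /= e0 leq_addr.
rewrite /update /= e0 e6 !add0n addn0 => st1 a1 m1 fr1.
apply: runs_addr_seq => //; try by rewrite fr1 //= ?e0 ?leq_addr.
rewrite !fr1 //= e0 e1 e6 !add0n addn0 => st2 a2 m2 fr2.
apply: runs_seq; apply: runs_index; apply: runs_seq; apply: runs_index.
apply: runs_seq; apply: runs_index; apply: runs_seq; apply: runs_real.
have f0 : reg st2 0 = n by rewrite fr2 // fr1.
have f1 : reg st2 1 = d by rewrite fr2 // fr1.
have f2 : reg st2 2 = 1%N by rewrite fr2 // fr1.
have f6 : reg st2 6 = 0%N by rewrite fr2 // fr1.
have f3 : reg st2 3 = (n * n)%N by rewrite fr2.
apply: H => /=.
- by split; split; rewrite /= /update /= ?a2 ?f3 ?f2 ?addn1.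
- by rewrite /update /= f3 a2 f2 addn1 eqxx.
- move=> a an; rewrite /update /= f3 a2 f2 addn1 ifF ?m2 ?m1 //.
  by apply/eqP; lia.
Qed.

End Correct.

Lemma fw_nonneg (w : nat -> nat -> R) : (forall i j, 0 <= w i j) ->
  forall k i j, 0 <= fw w k i j.
Proof. by move=> w0; elim=> //= k IH i j; rewrite le_min IH addr_ge0. Qed.

Section Program.
Variables (n d : nat) (x : nat -> nat -> R).
Local Notation w := (fun i j => \sum_(k < d) (x i k - x j k) ^+ 2).

Lemma fw_diag k i : fw w k i i = 0.
Proof.
elim: k => [|k IH] /=.
  by rewrite big1 // => l _; rewrite subrr expr0n.
rewrite IH min_r // addr_ge0 // fw_nonneg // => a b.
  by apply: sumr_ge0 => l _; exact: sqr_ge0.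
by apply: sumr_ge0 => l _; exact: sqr_ge0.
Qed.

(** The innermost rounds of the distance and relaxation phases are cubic in number and each spends
    linear time on addresses, whence the fourth power. *)
Lemma runs_edges st0 : reg st0 0 = n -> reg st0 1 = d -> reg st0 6 = 0%N ->
  (forall i k, (i < n)%N -> (k < d)%N -> memory st0 (i * d + k)%N = x i k) ->
  runs prog_edges st0 (100 * (n + d).+1 ^ 4)
    (fun st => forall i j, (i < n)%N -> (j < n)%N ->
       memory st (i * n + j)%N = fw w n i j / 2).
Proof.
move=> e0 e1 e6 mx; set N := (n + d)%N.
pose t1 := (2 + n * (2 + n * (3 + N * 3 + (1 + (2 + d * (3 + N * 3 + (3 + N * 3 + 3) + 2))) +
  2) + 2))%N.
pose t2 := (2 + n * (2 + n * (2 + n * (3 + N * 3 + (3 + N * 3 + (3 + N * 3 + 3)) + 2) + 2) +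
  2))%N.
pose t3 := (2 + n * (2 + n * (3 + N * 3 + (3 + N * 3 + 1) + 2) + 2))%N.
apply: (@runs_weaken _ _ (1 + (3 + N * 3 + (3 + N * 3 + (1 + (1 + (1 + (1 + (t1 + (t2 +
  t3))))))))) _ _ _ _ _ (fun _ => id)); last first.
  have nN : (n <= N)%N by rewrite leq_addr.
  have dN : (d <= N)%N by rewrite leq_addl.
  have t1N : (t1 <= 2 + N * (2 + N * (3 + N * 3 + (1 + (2 + N * (3 + N * 3 + (3 + N * 3 + 3)
    + 2))) + 2) + 2))%N.
    by rewrite /t1; do ![apply: leq_add => // | apply: leq_mul => //].
  have t2N : (t2 <= 2 + N * (2 + N * (2 + N * (3 + N * 3 + (3 + N * 3 + (3 + N * 3 + 3)) + 2)
    + 2) + 2))%N.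
    by rewrite /t2; do ![apply: leq_add => // | apply: leq_mul => //].
  have t3N : (t3 <= 2 + N * (2 + N * (3 + N * 3 + (3 + N * 3 + 1) + 2) + 2))%N.
    by rewrite /t3; do ![apply: leq_add => // | apply: leq_mul => //].
  clearbody N t1 t2 t3; rewrite !expnS expn0; nia.
apply: runs_init => // st1 env1 two1 m1.
apply: runs_seq; apply: runs_weaken.
- apply: runs_frame; apply: (runs_dist (x := x)) env1 _ => i k ilt klt.
  by rewrite m1 ?mx //; have := leq_mul ilt (leqnn d); rewrite mulSn; lia.
- exact: leqnn.
move=> st2 [H2 fr2].
have env2 : env n d st2 by apply: env_frame env1 _ fr2.
apply: runs_seq; apply: runs_weaken.
- apply: runs_frame; apply: (runs_relax (w := w)) env2 _ _.
    by move=> k _; exact: fw_diag.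
  by move=> a an; rewrite H2 ?an //; lia.
- exact: leqnn.
move=> st3 [H3 fr3].
have env3 : env n d st3 by apply: env_frame env2 _ fr3.
apply: runs_weaken.
- by apply: runs_half env3 _; rewrite H3 ?ifF ?H2 ?ifF //; lia.
- exact: leqnn.
move=> st4 H4 i j ilt jlt.
have ij : (i * n + j < n * n)%N.
  by have := leq_mul ilt (leqnn n); rewrite mulSn; lia.
rewrite H4 // H3 ?ifT ?addKn; try lia.
by rewrite divnMDl ?modnMDl ?divn_small ?modn_small ?addn0 //; lia.
Qed.

End Program.
End RAM.

Local Open Scope classical_set_scope.
Local Open Scope ring_scope.

(** * Kirszbraun's theorem *)

Section Euclid.
Context (R : realType).

Section Dim.
Variable d : nat.
Implicit Types x y z : 'rV[R]_d.

Definition dot x y : R := \sum_(i < d) x 0 i * y 0 i.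

Lemma dotC x y : dot x y = dot y x.
Proof. by apply: eq_bigr => i _; rewrite mulrC. Qed.

Lemma dotDl x y z : dot (x + y) z = dot x z + dot y z.
Proof. by rewrite -big_split; apply: eq_bigr => i _; rewrite mxE mulrDl. Qed.

Lemma dotZl a x y : dot (a *: x) y = a * dot x y.
Proof. by rewrite mulr_sumr; apply: eq_bigr => i _; rewrite mxE mulrA. Qed.

Lemma dotNl x y : dot (- x) y = - dot x y.
Proof. by rewrite -scaleN1r dotZl mulN1r. Qed.

Lemma dotDr x y z : dot z (x + y) = dot z x + dot z y.
Proof. by rewrite !(dotC z) dotDl. Qed.

Lemma dotZr a x y : dot y (a *: x) = a * dot y x.
Proof. by rewrite !(dotC y) dotZl. Qed.

Lemma dotNr x y : dot y (- x) = - dot y x.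
Proof. by rewrite !(dotC y) dotNl. Qed.

Definition dotE := (dotDl, dotDr, dotNl, dotNr, dotZl, dotZr).

Lemma dot_suml n (u : 'I_n -> 'rV[R]_d) y :
  dot (\sum_(j < n) u j) y = \sum_(j < n) dot (u j) y.
Proof.
rewrite /dot exchange_big; apply: eq_bigr => i _ /=.
by rewrite summxE mulr_suml.
Qed.

Lemma dot_sumr n (u : 'I_n -> 'rV[R]_d) y :
  dot y (\sum_(j < n) u j) = \sum_(j < n) dot y (u j).
Proof. by rewrite dotC dot_suml; apply: eq_bigr => j _; rewrite dotC. Qed.

Lemma dot_ge0 x : 0 <= dot x x.
Proof. by apply: sumr_ge0 => i _; rewrite -expr2 sqr_ge0. Qed.

Lemma enormE x : enorm x = Num.sqrt (dot x x).
Proof. by rewrite /enorm; congr Num.sqrt; apply: eq_bigr => i _; rewrite expr2. Qed.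

Lemma enorm_sqr x : enorm x ^+ 2 = dot x x.
Proof. by rewrite enormE sqr_sqrtr // dot_ge0. Qed.

Lemma enorm_ge0 x : 0 <= enorm x.
Proof. exact: sqrtr_ge0. Qed.

Lemma enorm0 : enorm (0 : 'rV[R]_d) = 0.
Proof. by rewrite /enorm big1 ?sqrtr0 // => i _; rewrite mxE expr0n. Qed.

Lemma enorm_eq0 x : enorm x <= 0 -> x = 0.
Proof.
move=> x0; have e0 : enorm x = 0 by apply/eqP; rewrite eq_le x0 enorm_ge0.
have /eqP : dot x x = 0 by rewrite -enorm_sqr e0 expr0n.
rewrite psumr_eq0 => [/allP h|i _]; last by rewrite -expr2 sqr_ge0.
apply/rowP => i; rewrite mxE; have := h i (mem_index_enum i).
by rewrite /= mulf_eq0 orbb => /eqP.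
Qed.

Lemma enormN x : enorm (- x) = enorm x.
Proof. by rewrite !enormE !dotE opprK. Qed.

Lemma enormB x y : enorm (x - y) = enorm (y - x).
Proof. by rewrite -enormN opprB. Qed.

Lemma enormZ a x : enorm (a *: x) = `|a| * enorm x.
Proof. by rewrite !enormE !dotE mulrA -expr2 sqrtrM ?sqr_ge0 // sqrtr_sqr. Qed.

Lemma dot_enorm x y : dot x y <= enorm x * enorm y.
Proof.
have [x0|x0] := leP (enorm x) 0.
  rewrite (enorm_eq0 x0) enorm0 mul0r /dot big1 // => i _.
  by rewrite mxE mul0r.
have [y0|y0] := leP (enorm y) 0.
  rewrite (enorm_eq0 y0) enorm0 mulr0 /dot big1 // => i _.
  by rewrite mxE mulr0.
have := dot_ge0 (enorm y *: x - enorm x *: y).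
rewrite !dotE -!enorm_sqr (dotC y x) => h.
have : 0 < enorm x * enorm y by rewrite mulr_gt0.
nra.
Qed.

Lemma enormD x y : enorm (x + y) <= enorm x + enorm y.
Proof.
rewrite -(ler_pXn2r (n := 2)) ?nnegrE ?addr_ge0 ?enorm_ge0 //.
rewrite sqrrD !enorm_sqr !dotE (dotC y x) -addrA [X in _ <= _ + X + _]mulr2n.
have := dot_enorm x y; lra.
Qed.

Lemma enorm_triangle x y z : enorm (x - z) <= enorm (x - y) + enorm (y - z).
Proof. by rewrite -[x - z](subrKA y) enormD. Qed.

(* Twice the variance, computed from the pairwise differences. *)
Lemma variance n (c : 'I_n -> R) (u : 'I_n -> 'rV[R]_d) : \sum_j c j = 1 ->
  \sum_j \sum_k c j * c k * dot (u j - u k) (u j - u k) =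
  2 * (\sum_j c j * dot (u j) (u j) -
       dot (\sum_j c j *: u j) (\sum_j c j *: u j)).
Proof.
move=> c1.
have -> : dot (\sum_j c j *: u j) (\sum_j c j *: u j) =
          \sum_j \sum_k c j * c k * dot (u j) (u k).
  rewrite dot_suml; apply: eq_bigr => j _; rewrite dot_sumr.
  by apply: eq_bigr => k _; rewrite !dotE mulrA.
have s1 : \sum_j \sum_k c j * c k * dot (u j) (u j) = \sum_j c j * dot (u j) (u j).
  by apply: eq_bigr => j _; rewrite -mulr_suml -mulr_sumr c1 mulr1.
have s2 : \sum_j \sum_k c j * c k * dot (u k) (u k) = \sum_j c j * dot (u j) (u j).
  rewrite exchange_big -s1; apply: eq_bigr => j _; apply: eq_bigr => k _ /=.
  by rewrite [c k * c j]mulrC.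
rewrite mulrBr (_ : 2 * \sum_j c j * dot (u j) (u j) =
  \sum_j \sum_k c j * c k * dot (u j) (u j) +
  \sum_j \sum_k c j * c k * dot (u k) (u k)); last by rewrite s1 s2; ring.
rewrite -big_split /= mulr_sumr -sumrB; apply: eq_bigr => j _.
rewrite -big_split /= mulr_sumr -sumrB; apply: eq_bigr => k _.
rewrite !dotE (dotC (u k) (u j)); ring.
Qed.

End Dim.

Lemma enorm_le d m (x : 'rV[R]_d) (y : 'rV[R]_m) : dot x x <= dot y y -> enorm x <= enorm y.
Proof. by rewrite !enormE; apply: ler_wsqrtr. Qed.


Lemma continuous_sum (T : topologicalType) n (f : 'I_n -> T -> R) :
  (forall i, continuous (f i)) -> continuous (fun x => \sum_(i < n) f i x).
Proof.
move=> h x; apply: cvg_big => [|i _]; last exact: h.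
exact: add_continuous.
Qed.

(** Let [t] tend to 0. This turns maximality along a segment into a first-order condition. *)
Lemma small_slope (B C : R) : (forall t, 0 < t <= 1 -> B <= t * C) -> B <= 0.
Proof.
move=> h; rewrite leNgt; apply/negP => B0.
have C0 : 0 < C by have := h 1; rewrite ltr01 lexx mul1r => /(_ isT); apply: lt_le_trans.
have := h (Num.min 1 (B / (2 * C))).
rewrite lt_min ltr01 divr_gt0 ?mulr_gt0 //= ge_min lexx => /(_ isT).
rewrite leNgt => /negP; apply.
apply: (@le_lt_trans _ _ (B / (2 * C) * C)); first by rewrite ler_pM2r // ge_min lexx orbT.
have -> : B / (2 * C) * C = B / 2 by field; rewrite gt_eqF.
lra.
Qed.

(* The centre is the barycentre of the q_j for the weights maximising a
   concave quadratic form on the simplex: the first-order conditions at the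
   maximum bound every distance by the maximal value, and that value is
   nonpositive because the variance of the q_j is at most that of the p_j. *)
Lemma kirszbraun d m n (p : 'I_n -> 'rV[R]_d) (q : 'I_n -> 'rV[R]_m) x :
  (forall i j, enorm (q i - q j) <= enorm (p i - p j)) ->
  exists y, forall i, enorm (y - q i) <= enorm (x - p i).
Proof.
case: n => [|n] in p q *; first by exists 0; case.
move=> pq.
(* On the simplex, [phi c] is the variance of the [q j] under the weights [c] minus the weighted
   mean of the squared distances from [x] to the [p j]. *)
pose a i : R := dot (q i) (q i) - dot (p i - x) (p i - x).
pose ctr (c : 'rV[R]_n.+1) := \sum_j c 0 j *: q j.
pose phi (c : 'rV[R]_n.+1) := \sum_j c 0 j * a j - dot (ctr c) (ctr c).
pose simplex := [set c : 'rV[R]_n.+1 | (forall i, 0 <= c 0 i) /\ \sum_j c 0 j = 1].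
have coord j : continuous (fun c : 'rV[R]_n.+1 => c 0 j) by exact: coord_continuous.
have csum (f : 'I_n.+1 -> R) : continuous (fun c : 'rV[R]_n.+1 => \sum_j c 0 j * f j).
  apply: continuous_sum => j c;
    apply: (@continuousM _ _ (fun c : 'rV[R]_n.+1 => c 0 j) (fun=> f j));
      [exact: coord | exact: cst_continuous].
have phic : continuous phi.
  have -> : phi = (fun c : 'rV[R]_n.+1 => \sum_j c 0 j * a j) - (fun c => dot (ctr c) (ctr
    c)) by [].
  move=> c; apply: continuousB; first exact: csum.
  move: c.
  apply: (@continuous_sum _ m (fun i c => ctr c 0 i * ctr c 0 i)) => i z.
  have h : {for z, continuous (fun c => ctr c 0 i)}.
    have E b : ctr b 0 i = \sum_j b 0 j * q j 0 i.
      by rewrite summxE; apply: eq_bigr => j _; rewrite mxE.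
    have -> : (fun c => ctr c 0 i) = (fun b : 'rV[R]_n.+1 => \sum_j b 0 j * q j 0 i) by
      exact/funext.
    exact: csum.
  exact: (continuousM h h).
have [c []] : exists2 c, c \in simplex & forall t, t \in simplex -> phi t <= phi c.
  apply: EVT_max_rV.
  - exists (delta_mx 0 ord0); split=> [i|]; first by rewrite mxE ler0n.
    rewrite (bigD1 ord0) //= big1 ?mxE ?eqxx ?addr0 // => j j0.
    by rewrite mxE (negbTE j0) andbF.
  - apply: (@subclosed_compact _ _ [set c : 'rV[R]_n.+1 | forall i, `[0, 1]%classic (c 0 i)]).
    + have -> : simplex = \bigcap_i [set c : 'rV[R]_n.+1 | 0 <= c 0 i] `&`
          [set c : 'rV[R]_n.+1 | \sum_j c 0 j = 1].
        apply/seteqP; split => z [] h1 h2; split=> // i; last exact: (h1 i).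
        by move=> _; exact: (h1 i).
      apply: closedI.
        apply: closed_bigI => i _.
        have := @preimage_closed _ _ (fun c : 'rV[R]_n.+1 => c 0 i) [set y : R | 0 <= y].
        by apply; [move=> z _; exact: coord | exact: closed_ge].
      have := @preimage_closed _ _ (fun c : 'rV[R]_n.+1 => \sum_j c 0 j) [set y : R | y = 1].
      by apply; [move=> z _; apply: continuous_sum => j b; exact: coord | exact: closed_eq].
    + by have := @rV_compact R n.+1 (fun=> `[0, 1]%classic); apply=> i; exact: segment_compact.
    + move=> z [z0 z1] i; rewrite /= in_itv /= z0 -z1 (bigD1 i) //= lerDl.
      exact: sumr_ge0.
  - exact: continuous_subspaceT.
rewrite inE => -[c0 c1] cmax.
(* Translating the [p j] by [x] keeps their differences, so by [variance] their mean squared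
   distance to [x] is at least their variance, which is at least that of the [q j]. *)
have phi_le0 : phi c <= 0.
  have := variance q c1; have := variance (fun j => p j - x) c1.
  set Sp := \sum_j \sum_k _; set Sq := \sum_j \sum_k _ => Ep Eq.
  have : Sq <= Sp.
    apply: ler_sum => j _; apply: ler_sum => k _; apply: ler_wpM2l.
      exact: mulr_ge0.
    rewrite -!enorm_sqr lerXn2r ?nnegrE ?enorm_ge0 //.
    by rewrite opprB addrA subrK pq.
  have := dot_ge0 (\sum_j c 0 j *: (p j - x)).
  rewrite /phi (_ : \sum_j c 0 j * a j = \sum_j c 0 j * dot (q j) (q j) -
      \sum_j c 0 j * dot (p j - x) (p j - x)); last first.
    by rewrite -sumrB; apply: eq_bigr => j _; rewrite mulrBr.
  by move: Ep Eq; rewrite /ctr; lra.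
exists (ctr c) => i; apply: enorm_le.
(* The segment from the maximiser [c] to the [i]-th vertex of the simplex; along it [ctr] moves
   straight from [ctr c] to [q i]. *)
pose e t : 'rV[R]_n.+1 := (1 - t) *: c + t *: delta_mx 0 i.
have delta_sum (f : 'I_n.+1 -> R) : \sum_j (delta_mx 0 i : 'rV[R]_n.+1) 0 j * f j = f i.
  rewrite (bigD1 i) //= big1 ?mxE ?eqxx ?mul1r ?addr0 // => j ji.
  by rewrite mxE (negbTE ji) andbF mul0r.
have esum t (f : 'I_n.+1 -> R) : \sum_j e t 0 j * f j = (1 - t) * \sum_j c 0 j * f j + t * f i.
  rewrite -(delta_sum f) !mulr_sumr -big_split; apply: eq_bigr => j _ /=.
  by rewrite !mxE mulrDl !mulrA.
have ectr t : ctr (e t) = (1 - t) *: ctr c + t *: q i.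
  apply/rowP => k; rewrite !mxE !summxE.
  under eq_bigr do rewrite mxE; rewrite esum.
  by under [in RHS]eq_bigr do rewrite mxE.
have et t : 0 < t <= 1 -> phi (e t) <= phi c.
  move=> /andP[t0 t1]; apply: cmax; rewrite inE; split=> [j|].
    by rewrite !mxE addr_ge0 // mulr_ge0 ?c0 ?subr_ge0 ?ler0n // ltW.
  have := esum t (fun=> 1); under eq_bigr do rewrite mulr1.
  by under [in X in _ -> X]eq_bigr do [] => ->; under eq_bigr do rewrite mulr1; rewrite c1;
    ring.
have slope : a i - \sum_j c 0 j * a j - 2 * dot (ctr c) (q i - ctr c) <= 0.
  apply: (small_slope (C := dot (q i - ctr c) (q i - ctr c))) => t t01.
  have /andP[t0 _] := t01; have := et t t01; rewrite /phi esum ectr.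
  rewrite !dotE (dotC (q i) (ctr c)) => h.
  rewrite -(ler_pM2l t0); move: h; nra.
(* The difference of the squared distances is [a i + dot (ctr c) (ctr c) - 2 * dot (ctr c) (q i)],
   which [slope] bounds by [phi c]. *)
move: phi_le0 slope; rewrite /phi /a !dotE (dotC (q i) (ctr c)) (dotC x (p i)); lra.
Qed.

End Euclid.

(** * The potential *)

Section Potential.
Context (R : realType).

Lemma kirszbraun_seq d m (L : seq ('rV[R]_d * 'rV[R]_m)) x :
  {in L &, forall a b, enorm (a.2 - b.2) <= enorm (a.1 - b.1)} ->
  exists y, {in L, forall a, enorm (y - a.2) <= enorm (x - a.1)}.
Proof.
move=> H.
have [|y hy] := @kirszbraun R d m (size L) (fun i => (nth 0 L i).1)
  (fun i => (nth 0 L i).2) x.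
  by move=> i j; apply: H; exact: mem_nth.
exists y => a aL; have ai : (index a L < size L)%N by rewrite index_mem.
by have := hy (Ordinal ai); rewrite /= nth_index.
Qed.

(** * The distance to the nearest point *)

Section NNDist.
Variable d : nat.
Implicit Types (P : {fset 'rV[R]_d}) (x y p : 'rV[R]_d).

Lemma nn_dist_le P y p : p \in P -> nn_dist P y <= enorm (p - y).
Proof.
rewrite /nn_dist; move: (enorm (head 0 P - y)) => e0.
rewrite -[p \in P]/(p \in (P : seq _)); elim: (P : seq _) => // x s IH.
rewrite inE big_cons ge_min => /orP[/eqP ->|/IH ->]; first by rewrite lexx.
by rewrite orbT.
Qed.

Lemma nn_dist_attained P y : P != fset0 ->
  exists2 p, p \in P & nn_dist P y = enorm (p - y).
Proof.
move=> P0; pose K e := exists2 p, p \in P & e = enorm (p - y).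
rewrite /nn_dist big_seq; apply: (big_ind K).
- exists (head 0 P) => //; have /fset0Pn[p] := P0.
  rewrite -[p \in P]/(p \in (P : seq _)) -[_ \in P]/(_ \in (P : seq _)).
  by case: (P : seq _) => // z s _; exact: mem_head.
- by move=> e e' he he'; rewrite minEle; case: ifP.
- by move=> p pP; exists p.
Qed.

Lemma nn_dist_lip P x y : P != fset0 -> nn_dist P x <= nn_dist P y + enorm (x - y).
Proof.
move=> P0; have [p pP ->] := nn_dist_attained y P0.
apply: le_trans (nn_dist_le x pP) _.
by rewrite (enormB x y) enorm_triangle.
Qed.

Lemma nn_dist_ge0 P x : P != fset0 -> 0 <= nn_dist P x.
Proof. by move=> P0; have [p _ ->] := nn_dist_attained x P0; exact: enorm_ge0. Qed.

End NNDist.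

(* The antiderivative of 4 min (t, l - t) on [0, l], extended by constants. *)
Definition ramp (l t : R) : R :=
  let s := Num.max 0 (Num.min l t) in
  if s <= l / 2 then 2 * s ^+ 2 else l ^+ 2 - 2 * (l - s) ^+ 2.

Lemma ramp0 (l : R) : 0 <= l -> ramp l 0 = 0.
Proof.
by move=> l0; rewrite /ramp min_r // maxxx divr_ge0 // expr0n mulr0.
Qed.

Lemma ramp_end (l : R) : 0 <= l -> ramp l l = l ^+ 2.
Proof.
move=> l0; rewrite /ramp minxx max_r //; case: ifP => [h|_].
  have l1 : l = 0 by lra.
  by rewrite l1 expr0n mulr0.
by rewrite subrr expr0n mulr0 subr0.
Qed.

(** The slope at [s] is [4 min (s, l - s)], hence at most [4 m], and it varies by at most 4 times
    the distance moved. The cases are the halves of [[0, l]] containing [s] and [s']; the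
    nonnegative products are the certificates for linear arithmetic. *)
Lemma ramp_core (l s s' m : R) : 0 <= s -> s <= l -> 0 <= s' -> s' <= l ->
  s <= m \/ l - s <= m ->
  `|(if s <= l / 2 then 2 * s ^+ 2 else l ^+ 2 - 2 * (l - s) ^+ 2) -
    (if s' <= l / 2 then 2 * s' ^+ 2 else l ^+ 2 - 2 * (l - s') ^+ 2)| <=
  4 * (m + `|s - s'|) * `|s - s'|.
Proof.
move=> s0 sl s0' sl' hm; rewrite ler_norml.
have m0 : 0 <= m by case: hm => hm; lra.
have P (z z' : R) : 0 <= z -> 0 <= z' -> 0 <= z * z' by exact: mulr_ge0.
have Q (z : R) : 0 <= z * z by rewrite -expr2 sqr_ge0.
have [ss|ss] := leP s s'.
  rewrite (distrC s s') (@ger0_norm _ (s' - s)) ?subr_ge0 //.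
  case: (leP s (l / 2)) => h1; case: (leP s' (l / 2)) => h2.
  - have h : 0 <= (m - s) * (s' - s) by apply: P; case: hm => hm; lra.
    have h' : 0 <= s * (s' - s) by apply: P; lra.
    by have q := Q (s' - s); apply/andP; split; lra.
  - have h : 0 <= (m - s) * (s' - s) by apply: P; case: hm => hm; lra.
    have h' : 0 <= s * (l - 2 * s) by apply: P; lra.
    have h'' : 0 <= l * (l - 2 * s) by apply: P; lra.
    have k' : 0 <= (l - s') * (2 * s' - l) by apply: P; lra.
    have k'' : 0 <= l * (2 * s' - l) by apply: P; lra.
    have k : 0 <= m * (s' - s) by apply: P; lra.
    by have q := Q (s' - s); have q' := Q (l - 2 * s'); apply/andP; split; lra.
  - by exfalso; lra.
  - have h : 0 <= (m - (l - s)) * (s' - s) by apply: P; case: hm => hm; lra.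
    have h' : 0 <= (l - s) * (s' - s) by apply: P; lra.
    have h'' : 0 <= (l - s') * (s' - s) by apply: P; lra.
    by have q := Q (s' - s); apply/andP; split; lra.
rewrite (@gtr0_norm _ (s - s')) ?subr_gt0 //.
case: (leP s (l / 2)) => h1; case: (leP s' (l / 2)) => h2.
- have h : 0 <= (m - s) * (s - s') by apply: P; case: hm => hm; lra.
  have h' : 0 <= s' * (s - s') by apply: P; lra.
  by have q := Q (s' - s); apply/andP; split; lra.
- by exfalso; lra.
- have h : 0 <= (m - (l - s)) * (s - s') by apply: P; case: hm => hm; lra.
  have h' : 0 <= s' * (l - 2 * s') by apply: P; lra.
  have h'' : 0 <= l * (l - 2 * s') by apply: P; lra.
  have k' : 0 <= (l - s) * (2 * s - l) by apply: P; lra.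
  have k'' : 0 <= l * (2 * s - l) by apply: P; lra.
  have k : 0 <= m * (s - s') by apply: P; lra.
  by have q := Q (s' - s); have q' := Q (l - 2 * s'); apply/andP; split; lra.
- have h : 0 <= (m - (l - s)) * (s - s') by apply: P; case: hm => hm; lra.
  have h' : 0 <= (l - s) * (s - s') by apply: P; lra.
  by have q := Q (s' - s); apply/andP; split; lra.
Qed.

(** Projection onto [[0, l]] shrinks distances and fixes the end [e], so [ramp_core] applies to the
    projected points, with [m] the distance from the projection of [t] to [e]. *)
Lemma ramp_lip (l e t t' : R) : 0 <= l -> e = 0 \/ e = l ->
  `|ramp l t - ramp l t'| <= 4 * (`|t - e| + `|t - t'|) * `|t - t'|.
Proof.
move=> l0 e0l; pose cl (z : R) : R := Num.max 0 (Num.min l z).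
have clP (z : R) : 0 <= cl z <= l.
  by rewrite /cl le_max lexx ge_max l0 ge_min lexx.
have clS (z : R) : z <= 0 /\ cl z = 0 \/ 0 <= z <= l /\ cl z = z \/ l <= z /\ cl z = l.
  rewrite /cl; have [z0|z0] := leP z 0.
    by left; rewrite min_r ?max_l //; lra.
  right; have [zl|zl] := leP z l.
    by left; rewrite ?max_r //; try split=> //; lra.
  by right; rewrite ?max_r //; try split=> //; lra.
have cl_lip (z z' : R) : `|cl z - cl z'| <= `|z - z'|.
  have := ler_norm (z - z'); have := ler_norm (z' - z); rewrite (distrC z' z).
  move: (`|z - z'|) (clS z) (clS z') => D.
  move=> [[a ->]|[[a ->]|[a ->]]] [[b ->]|[[b ->]|[b ->]]] h1 h2;
    rewrite ler_norml; lra.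
have cle : cl e = e.
  by rewrite /cl; case: e0l => ->; rewrite ?minxx ?max_r ?min_r // maxxx.
apply: (@le_trans _ _ (4 * (`|cl t - e| + `|cl t - cl t'|) * `|cl t - cl t'|)); last first.
  apply: ler_pM; rewrite ?mulr_ge0 ?addr_ge0 //.
  by rewrite ler_pM2l // lerD // -{1}cle.
have [c0 cl'] := andP (clP t); have [c0' cl''] := andP (clP t').
apply: ramp_core => //.
case: e0l => ->; rewrite ?subr0; first by left; exact: ler_norm.
by right; rewrite distrC; exact: ler_norm.
Qed.

(** * A staircase with prescribed squared distances *)

Section Staircase.
Variables (m : nat) (v : nat -> R).
Hypothesis vmono : forall i j, (i <= j <= m)%N -> v i <= v j.

Definition step (j : nat) : R := Num.sqrt (v j.+1 - v j).

(* Vertices of a monotone path along the edges of a box; squared Euclidean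
   distances between them are differences of values of v. *)
Definition stair (u : nat) : 'rV[R]_m := \row_(j < m) if (j < u)%N then step j else 0.

Definition height (y : 'rV[R]_m) : R := \sum_(j < m) ramp (step j) (y 0 j).

Lemma step_sqr j : (j < m)%N -> step j ^+ 2 = v j.+1 - v j.
Proof. by move=> jm; rewrite sqr_sqrtr // subr_ge0 vmono // leqnSn. Qed.

Lemma sum_steps u : (u <= m)%N ->
  \sum_(j < m) (if (j < u)%N then v j.+1 - v j else 0) = v u - v 0.
Proof.
move=> um; rewrite -big_mkcond /= -(big_ord_widen _ (fun j => v j.+1 - v j) um).
by rewrite -(big_mkord xpredT (fun j => v j.+1 - v j)) telescope_sumr.
Qed.

(** Each completed coordinate contributes the full square of its step, so [height] inverts the
    staircase up to the constant [v 0]. *)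
Lemma height_stair u : (u <= m)%N -> height (stair u) = v u - v 0.
Proof.
move=> um; rewrite -(sum_steps um); apply: eq_bigr => j _; rewrite mxE.
by case: ifP => _; rewrite ?ramp0 ?ramp_end ?sqrtr_ge0 // step_sqr.
Qed.

(** Two vertices differ only in the coordinates between their indices, and the squares of those
    steps telescope. *)
Lemma stair_dist u u' : (u <= m)%N -> (u' <= m)%N ->
  enorm (stair u - stair u') ^+ 2 = `|v u - v u'|.
Proof.
wlog uu' : u u' / (u' <= u)%N => [H um um'|um um'].
  by case: (leqP u' u) => uu'; [|rewrite enormB distrC]; apply: H => //; exact: ltnW.
rewrite ger0_norm ?subr_ge0 ?vmono ?uu' //.
rewrite -(subrKA (v 0)) -[v 0 - v u']opprB -(sum_steps um) -(sum_steps um') -sumrB.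
rewrite enorm_sqr; apply: eq_bigr => j _; rewrite !mxE -expr2.
case: (ltnP j u') => ju'.
  by rewrite (leq_trans ju' uu') !subrr expr0n.
by rewrite !subr0; case: ifP => _; rewrite ?expr0n // step_sqr.
Qed.

(** Each coordinate of [stair u] is an end of its side, so [ramp_lip] applies coordinatewise;
    Cauchy-Schwarz for the vectors of absolute values collects the terms. The vertex [u] can be
    chosen to suit [y]. *)
Lemma height_lip u y y' :
  `|height y - height y'| <= 4 * (enorm (y - stair u) + enorm (y - y')) * enorm (y - y').
Proof.
pose ab (z : 'rV[R]_m) : 'rV[R]_m := \row_j `|z 0 j|.
have abE z : enorm (ab z) = enorm z.
  by rewrite !enormE; congr Num.sqrt; apply: eq_bigr => j _;
    rewrite !mxE -normrM ger0_norm // -expr2 sqr_ge0.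
pose e := y - stair u; pose f := y - y'.
apply: (@le_trans _ _ (4 * dot (ab e + ab f) (ab f))); last first.
  rewrite -mulrA ler_pM2l //; apply: le_trans (dot_enorm _ _) _.
  rewrite abE ler_wpM2r ?enorm_ge0 //; apply: le_trans (enormD _ _) _.
  by rewrite !abE.
rewrite /height -sumrB; apply: le_trans (ler_norm_sum _ _ _) _.
rewrite mulr_sumr; apply: ler_sum => j _; rewrite !mxE mulrA.
apply: ramp_lip; first exact: sqrtr_ge0.
by case: ifP; [right|left].
Qed.

End Staircase.

(** * Chains of points and the potential they define *)

Section ChainPotential.
Variables (d : nat) (P : {fset 'rV[R]_d}) (f : 'rV[R]_d -> R) (a : 'rV[R]_d).
Hypothesis aP : a \in P.
Hypothesis flip : forall p q, p \in P -> q \in P -> `|f p - f q| <= enorm (p - q) ^+ 2.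

(** A discrete stand-in for path length: on the segment from [x] to [y] the distance to [P] is at
    most [nn_dist P x + enorm (x - y)]. Chains are finite, so Kirszbraun's theorem can be applied to
    one new point at a time. *)
Fixpoint chain_cost (x : 'rV[R]_d) (s : seq 'rV[R]_d) : R :=
  if s is y :: s' then
    4 * (nn_dist P x + enorm (x - y)) * enorm (x - y) + chain_cost y s'
  else 0.

Definition chain_dist (x : 'rV[R]_d) : R :=
  inf [set chain_cost x s | s in [set s | last x s = a]].

Lemma P_neq0 : P != fset0. Proof. by apply/fset0Pn; exists a. Qed.

Lemma chain_cost_ge0 x s : 0 <= chain_cost x s.
Proof.
elim: s x => //= y s IH x; rewrite addr_ge0 // !mulr_ge0 ?addr_ge0 ?enorm_ge0 //.
exact: nn_dist_ge0 P_neq0.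
Qed.

Lemma chain_dist_le x s : last x s = a -> chain_dist x <= chain_cost x s.
Proof.
move=> sa; apply: ge_inf; last by exists s.
by exists 0 => _ [s' _ <-]; exact: chain_cost_ge0.
Qed.

Lemma le_chain_dist x c :
  (forall s, last x s = a -> c <= chain_cost x s) -> c <= chain_dist x.
Proof.
move=> H; apply: lb_le_inf; first by exists (chain_cost x [:: a]), [:: a].
by move=> _ [s sa <-]; exact: H.
Qed.

Lemma chain_dist_start : chain_dist a = 0.
Proof.
apply/eqP; rewrite eq_le (@chain_dist_le a [::]) //=.
by apply: le_chain_dist => s _; exact: chain_cost_ge0.
Qed.

Lemma chain_dist_step x y :
  chain_dist x <= 4 * (nn_dist P x + enorm (x - y)) * enorm (x - y) + chain_dist y.
Proof.
rewrite -lerBlDl; apply: le_chain_dist => s sa; rewrite lerBlDl.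
exact: (@chain_dist_le x (y :: s)).
Qed.

(** The step back from [y] is charged with [nn_dist P y]; replacing it by
    [nn_dist P x + enorm (x - y)] gives the factor 2. *)
Lemma chain_dist_lip x y :
  `|chain_dist x - chain_dist y| <= 4 * (nn_dist P x + 2 * enorm (x - y)) * enorm (x - y).
Proof.
have e0 := enorm_ge0 (x - y).
have xy := chain_dist_step x y; have yx := chain_dist_step y x.
have r := nn_dist_lip y x P_neq0; rewrite (enormB y x) in yx r.
have h : 0 <= (nn_dist P x + enorm (x - y) - nn_dist P y) * enorm (x - y).
  by rewrite mulr_ge0 // subr_ge0.
have h' : 0 <= enorm (x - y) * enorm (x - y) by exact: mulr_ge0.
by rewrite ler_norml; apply/andP; split; lra.
Qed.

(* The points of a chain are mapped one after the other to the space of a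
   staircase whose vertices are the images of the points of P. *)
Lemma chain_dist_ge b : b \in P -> f b - f a <= chain_dist b.
Proof.
(* The values of [f] on [P] in increasing order. Repeated values only give steps of length 0, and
   [m] is the last index. *)
move=> bP; pose S := sort <=%R [seq f p | p <- (P : seq _)].
pose m := (size S).-1; pose v := nth 0 S; pose u p := index (f p) S.
have fS p : p \in P -> f p \in S by move=> pP; rewrite mem_sort map_f.
have vmono i j : (i <= j <= m)%N -> v i <= v j.
  move=> /andP[ij jm]; have S0 : (0 < size S)%N by have := fS a aP; rewrite -index_mem;
    exact: leq_ltn_trans.
  apply: le_sorted_leq_nth => //; first exact: (sort_le_sorted _).
    by rewrite inE -(prednK S0) ltnS (leq_trans ij).
  by rewrite inE -(prednK S0) ltnS.
have um p : p \in P -> (u p <= m)%N.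
  by move=> pP; have := fS p pP; rewrite -index_mem -/(u p) /m; case: (size S).
have vu p : p \in P -> v (u p) = f p by move=> pP; rewrite /v nth_index // fS.
pose q p := stair m v (u p).
(* The squared distance between the images is the difference of the values of [f], so this is
   [flip]. *)
have qlip : forall p p', p \in P -> p' \in P -> enorm (q p - q p') <= enorm (p - p').
  move=> p p' pP pP'; rewrite -(ler_pXn2r (n := 2)) ?nnegrE ?enorm_ge0 //.
  by rewrite stair_dist ?um // !vu // flip.
(* Here [y] is the image of the current chain point [x]; it only has to be no farther from each
   [q p] than [x] is from [p]. *)
suff H : forall s x y, (forall p, p \in P -> enorm (y - q p) <= enorm (x - p)) ->
    last x s = a -> height v y - height v (q a) <= chain_cost x s.
  apply: le_chain_dist => s sa; have := H s b (q b) (fun p => qlip b p bP) sa.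
  by rewrite !height_stair ?um // !vu // opprB addrA subrK.
(* At the end of the chain [x] is [a], so [y] has distance 0 from [q a]. *)
elim=> [|x' s IH] x y hy /= sa.
  have := hy a aP; rewrite sa subrr enorm0 => /enorm_eq0 /eqP.
  by rewrite subr_eq0 => /eqP ->; rewrite subrr.
(* Kirszbraun's theorem places the next chain point; including [(x, y)] among the constraints
   controls the jump from [y] to [y']. *)
have [|y' hy'] := @kirszbraun_seq d m ((x, y) :: [seq (p, q p) | p <- (P : seq _)]) x'.
  move=> c c'; rewrite !inE => /orP[/eqP ->|/mapP[p pP ->]] /orP[/eqP ->|/mapP[p' pP' ->]] /=.
  - by rewrite !subrr !enorm0.
  - exact: hy.
  - by rewrite enormB [leRHS]enormB; exact: hy.
  - exact: qlip.
have yy' : enorm (y - y') <= enorm (x - x').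
  by rewrite enormB [leRHS]enormB; exact: (hy' (x, y) (mem_head _ _)).
have := IH x' y' _ sa.
have hp p : p \in P -> enorm (y' - q p) <= enorm (x' - p).
  by move=> pP; apply: (hy' (p, q p)); rewrite inE map_f ?orbT.
move=> /(_ hp) h.
(* The vertex used in [height_lip] is the image of the point of [P] nearest to [x], since [y] is
   within [nn_dist P x] of it. *)
have [p pP rx] := nn_dist_attained x P_neq0.
have step : height v y - height v y' <= 4 * (nn_dist P x + enorm (x - x')) * enorm (x - x').
  apply: le_trans (ler_norm _) _; apply: le_trans (height_lip v (u p) y y') _.
  apply: ler_pM; rewrite ?enorm_ge0 ?mulr_ge0 ?addr_ge0 ?enorm_ge0 //.
  rewrite ler_pM2l // lerD // rx (enormB p); exact: hy.
by move: h step; lra.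
Qed.

End ChainPotential.

Lemma potential d (P : {fset 'rV[R]_d}) (f : 'rV[R]_d -> R) a : a \in P ->
  (forall p q, p \in P -> q \in P -> `|f p - f q| <= enorm (p - q) ^+ 2) ->
  exists F : 'rV[R]_d -> R, [/\ F a = 0,
    forall b, b \in P -> f b - f a <= F b &
    forall x y, `|F x - F y| <= 4 * (nn_dist P x + 2 * enorm (x - y)) * enorm (x - y)].
Proof.
move=> aP flip; exists (chain_dist P a); split; first exact: chain_dist_start.
  by move=> b; exact: chain_dist_ge.
exact: chain_dist_lip.
Qed.

End Potential.

(** * Lengths of paths *)

Section Length.
Context (R : realType).
Local Notation mu := (@lebesgue_measure R).

Lemma enorm_continuous d : continuous (@enorm R d).
Proof.
move=> x; apply: (@continuous_comp _ _ _ (fun y : 'rV[R]_d => \sum_(i < d) y 0 i ^+ 2)).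
  apply: (@continuous_sum R _ d (fun i (y : 'rV[R]_d) => y 0 i ^+ 2)) => i y.
  have h : {for y, continuous (fun y : 'rV[R]_d => y 0 i)} by exact: coord_continuous.
  exact: (continuousM h h).
exact: sqrt_continuous.
Qed.

Lemma enorm_sub_continuous d (x : 'rV[R]_d) :
  continuous (fun y : 'rV[R]_d => enorm (x - y)).
Proof.
move=> y; apply: continuous_comp; last exact: enorm_continuous.
by apply: continuousB; [exact: cst_continuous | exact: cvg_id].
Qed.

Lemma continuous_majorant (T : topologicalType) (f rho : T -> R) x : rho x = 0 ->
  {for x, continuous rho} -> (forall y, `|f x - f y| <= rho y) ->
  {for x, continuous f}.
Proof.
move=> rho0 crho le; apply/cvgrPdist_lt => e e0.
have : \forall y \near x, rho y < e by apply: cvgr_lt crho _ _; rewrite rho0.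
by apply: filterS => y; exact: le_lt_trans.
Qed.

Lemma nn_dist_continuous d (P : {fset 'rV[R]_d}) : P != fset0 -> continuous (nn_dist P).
Proof.
move=> P0 x; apply: (@continuous_majorant 'rV[R]_d (nn_dist P) (fun y : 'rV[R]_d => enorm (x
  - y)) x).
- by rewrite subrr enorm0.
- exact: enorm_sub_continuous.
move=> y; have := nn_dist_lip x y P0; have := nn_dist_lip y x P0.
by rewrite (enormB y x) ler_norml; lra.
Qed.

(* A minimiser of phi minus a steep enough line would contradict the bound on
   the upper right derivative. *)
Lemma dini_le (phi : R -> R) (a b : R) : a < b -> {within `[a, b], continuous phi} ->
  (forall t e, t \in `]a, b[ -> 0 < e ->
     \forall h \near 0^'+, phi (t + h) - phi t <= e * h) ->
  phi b <= phi a.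
Proof.
move=> ab cphi dini; rewrite leNgt; apply/negP => lt.
(* Half the mean slope, so that [chi] still increases from [a] to [b]. *)
pose e := (phi b - phi a) / (2 * (b - a)).
have e0 : 0 < e by rewrite divr_gt0 ?mulr_gt0 ?subr_gt0.
pose chi t := phi t - e * (t - a).
have ce : continuous (fun t : R => e * (t - a)).
  move=> t; apply: (@continuousM _ _ (fun=> e) (fun t => t - a)).
    exact: cst_continuous.
  by apply: continuousB; [exact: cvg_id | exact: cst_continuous].
have cchi : {within `[a, b], continuous chi}.
  move=> t; apply: (@continuousB _ _ (subspace `[a, b]) phi (fun t => e * (t - a)));
    first exact: cphi.
  exact: continuous_subspaceT.
have chiab : chi a < chi b.
  rewrite /chi subrr mulr0 subr0 /e.
  have -> : (phi b - phi a) / (2 * (b - a)) * (b - a) = (phi b - phi a) / 2.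
    by field; rewrite subr_eq0 gt_eqF.
  lra.
(* The bound [dini] holds only inside []a, b[], so the left end is moved inwards before minimising;
   [chi a' < chi b] then keeps the minimiser away from [b]. *)
have [a' a'ab chia'] : exists2 a', a < a' < b & chi a' < chi b.
  have [_ ca _] := (continuous_within_itvP _ ab).1 cchi.
  have : \forall x \near a^'+, [/\ a < x, x < b & chi x < chi b].
    near=> x; split; near: x.
    - exact: nbhs_right_gt.
    - exact: nbhs_right_lt.
    - by move/cvgr_lt : ca; apply.
  by move=> /filter_ex[x [ax xb xc]]; exists x; rewrite ?ax.
have /andP[aa' a'b] := a'ab.
have cchi' : {within `[a', b], continuous chi}.
  apply: continuous_subspaceW cchi => t /=; rewrite !in_itv /=.
  by move=> /andP[h ->]; rewrite (le_trans (ltW aa')).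
have [c] := EVT_min (ltW a'b) cchi'; rewrite in_itv /= => /andP[a'c cb] cmin.
have cb' : c < b.
  rewrite lt_neqAle cb andbT; apply/eqP => cbE.
  have := cmin a'; rewrite in_itv /= lexx (ltW a'b) => /(_ isT).
  by rewrite cbE leNgt chia'.
have cab : c \in `]a, b[ by rewrite in_itv /= cb' (lt_le_trans aa').
have : \forall h \near 0^'+, [/\ 0 < h, h < b - c & phi (c + h) - phi c <= e / 2 * h].
  near=> h; split; near: h.
  - exact: nbhs_right_gt.
  - by apply: nbhs_right_lt; rewrite subr_gt0.
  - by apply: dini => //; rewrite divr_gt0.
move=> /filter_ex[h [h0 hb hphi]].
have := cmin (c + h); rewrite in_itv /= => /(_ _).
have -> : a' <= c + h by rewrite (le_trans a'c) // lerDl ltW.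
have -> : c + h <= b by rewrite -lerBrDl ltW.
move=> /(_ isT); rewrite /chi => hm.
have : 0 < e * h by rewrite mulr_gt0.
by move: hm hphi; lra.
Unshelve. all: by end_near. Qed.

Section Piece.
Variables (d : nat) (P : {fset 'rV[R]_d}) (F : 'rV[R]_d -> R).
Hypothesis P0 : P != fset0.
Hypothesis Flip : forall x y,
  `|F x - F y| <= 4 * (nn_dist P x + 2 * enorm (x - y)) * enorm (x - y).

Lemma potential_within A (g : R -> 'rV[R]_d) :
  {within A, continuous g} -> {within A, continuous (F \o g)}.
Proof.
move=> cg; apply: within_continuous_comp => // x _.
pose rho (y : 'rV[R]_d) := 4 * (nn_dist P x + 2 * enorm (x - y)) * enorm (x - y).
apply: (@continuous_majorant 'rV[R]_d F rho x) => [||y]; last exact: Flip.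
  by rewrite /rho subrr enorm0 !mulr0.
have h : {for x, continuous (fun y : 'rV[R]_d => enorm (x - y))} by exact: enorm_sub_continuous.
apply: (@continuousM _ 'rV[R]_d (fun y => 4 * (nn_dist P x + 2 * enorm (x - y)))) => //.
apply: (@continuousM _ 'rV[R]_d (fun=> 4)); first exact: cst_continuous.
apply: (@continuousD _ _ 'rV[R]_d (fun=> nn_dist P x)); first exact: cst_continuous.
by apply: (@continuousM _ 'rV[R]_d (fun=> 2)) => //; exact: cst_continuous.
Qed.

Definition speed (g v : R -> 'rV[R]_d) (t : R) : R := 4 * nn_dist P (g t) * enorm (v t).

Lemma speed_ge0 g v t : 0 <= speed g v t.
Proof. by rewrite !mulr_ge0 ?enorm_ge0 // nn_dist_ge0. Qed.

Lemma speed_within A g v : {within A, continuous g} -> {within A, continuous v} ->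
  {within A, continuous (speed g v)}.
Proof.
move=> cg cv.
have cr : {within A, continuous (nn_dist P \o g)}.
  by apply: within_continuous_comp => // x _; exact: nn_dist_continuous.
have cn : {within A, continuous (@enorm R d \o v)}.
  by apply: within_continuous_comp => // x _; exact: enorm_continuous.
move=> t; apply: (@continuousM _ (subspace A) (fun t => 4 * nn_dist P (g t))); last exact: cn.
apply: (@continuousM _ (subspace A) (fun=> 4)); last exact: cr.
exact: cst_continuous.
Qed.

(** Divided by [h], the bound [Flip] tends to [speed g v t], which is the derivative of [H] at [t].
    This controls difference quotients of [F \o g] without differentiating [F]. *)
Lemma potential_derivative (g v : R -> 'rV[R]_d) (H : R -> R) (t e : R) : 0 < e ->
  is_derive t 1 g (v t) -> derivable H t 1 -> derive1 H t = speed g v t ->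
  \forall h \near 0^'+, `|F (g (t + h)) - F (g t)| - (H (t + h) - H t) <= e * h.
Proof.
move=> e0 [dg g'E] dH H'E.
pose E h := enorm (h^-1 *: (g (h *: 1 + t) - g t)).
pose D h := h^-1 *: (H (h *: 1 + t) - H t).
have cE : E h @[h --> 0^'] --> enorm (v t).
  have cg : h^-1 *: (g (h *: 1 + t) - g t) @[h --> 0^'] --> v t.
    by rewrite -g'E; exact: dg.
  exact: (cvg_comp _ _ cg (@enorm_continuous d (v t))).
have cD : D h @[h --> 0^'] --> speed g v t by rewrite -H'E derive1E; exact: dH.
have ch : h @[h --> (0 : R)^'] --> (0 : R) by exact: nbhs_dnbhs.
pose Q h := 4 * (nn_dist P (g t) + 2 * (h * E h)) * E h - D h.
have cQ : Q h @[h --> 0^'] --> (0 : R).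
  suff : Q h @[h --> 0^'] -->
      4 * (nn_dist P (g t) + 2 * (0 * enorm (v t))) * enorm (v t) - speed g v t.
    by rewrite /speed mul0r mulr0 addr0 subrr.
  have c1 : h * E h @[h --> 0^'] --> 0 * enorm (v t) by exact: (cvgM ch cE).
  have c2 : 2 * (h * E h) @[h --> 0^'] --> 2 * (0 * enorm (v t)).
    by apply: (@cvgM R _ _ _ (fun=> 2) (fun h => h * E h)) => //; exact: cvg_cst.
  have c3 : nn_dist P (g t) + 2 * (h * E h) @[h --> 0^'] -->
      nn_dist P (g t) + 2 * (0 * enorm (v t)) 
      by apply: (@cvgD _ _ _ _ _ (fun=> nn_dist P (g t)) (fun h => 2 * (h * E h))) => //;
        exact: cvg_cst.
  have c4 : 4 * (nn_dist P (g t) + 2 * (h * E h)) @[h --> 0^'] -->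
      4 * (nn_dist P (g t) + 2 * (0 * enorm (v t))) 
      by apply: (@cvgM R _ _ _ (fun=> 4) (fun h => nn_dist P (g t) + 2 * (h * E h))) => //;
        exact: cvg_cst.
  apply: (@cvgB _ _ _ _ _ (fun h => 4 * (nn_dist P (g t) + 2 * (h * E h)) * E h) D) => //.
  apply: (@cvgM R _ _ _ (fun h => 4 * (nn_dist P (g t) + 2 * (h * E h))) E);
    [exact: c4 | exact: cE].
have /cvg_dnbhs_at_right /cvgr_lt /(_ _ e0) nQ := cQ.
near=> h.
have h0 : 0 < h by near: h; exact: nbhs_right_gt.
have : Q h < e by near: h.
rewrite /Q /E /D /= [h *: 1]mulr1 (addrC h t).
have -> : enorm (h^-1 *: (g (t + h) - g t)) = h^-1 * enorm (g t - g (t + h)).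
  by rewrite enormZ enormB gtr0_norm // invr_gt0.
have := Flip (g t) (g (t + h)); rewrite distrC.
move: (enorm _) (nn_dist _ _) `|_| => n r fd.
rewrite -(ltr_pM2r h0).
have -> : (4 * (r + 2 * (h * (h^-1 * n))) * (h^-1 * n) - h^-1 *: (H (t + h) - H t)) * h =
  4 * (r + 2 * n) * n - (H (t + h) - H t).
  by rewrite /GRing.scale /=; field; rewrite gt_eqF.
by lra.
Unshelve. all: by end_near. Qed.

Lemma potential_piece (a b : R) (g v : R -> 'rV[R]_d) : a < b ->
  {within `[a, b], continuous g} -> {within `[a, b], continuous v} ->
  (forall t, t \in `]a, b[ -> is_derive t 1 g (v t)) ->
  (`|F (g b) - F (g a)|%:E <= \int[mu]_(t in `[a, b]) (speed g v t)%:E)%E.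
Proof.
move=> ab cg cv dg.
have cW := speed_within cg cv.
have iW : mu.-integrable `[a, b] (EFin \o speed g v).
  by apply: continuous_compact_integrable => //; exact: segment_compact.
pose H t := parameterized_integral mu a t (speed g v).
have cH : {within `[a, b], continuous H}.
  by apply: parameterized_integral_continuous => //; exact: ltW.
have dH t : t \in `]a, b[ -> derivable H t 1 /\ derive1 H t = speed g v t.
  move=> tab; have := tab; rewrite in_itv /= => /andP[at0 tb].
  apply: (continuous_FTC1_closed tb iW at0).
  by have [c _ _] := (continuous_within_itvP _ ab).1 cW; exact: c.
have Ha : H a = 0 by rewrite /H /parameterized_integral set_itv1 Rintegral_set1.
have HbE : (\int[mu]_(t in `[a, b]) (speed g v t)%:E = (H b)%:E)%E.
  by rewrite /H /parameterized_integral /Rintegral fineK //; exact: integrable_fin_num.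
rewrite HbE lee_fin.
have cF := potential_within cg.
(* [H] is the length accumulated since [a]. For either sign [s] the function [s * F (g t) - H t] has
   nonpositive upper right derivative, and the two signs give the absolute value. *)
have key (s : R) : `|s| = 1 -> s * F (g b) - H b <= s * F (g a) - H a.
  move=> s1; apply: (dini_le (phi := fun t => s * F (g t) - H t)) => //.
    move=> t; apply: (@continuousB _ _ (subspace `[a, b]) (fun t => s * F (g t)) H);
      last exact: cH.
    apply: (@continuousM _ (subspace `[a, b]) (fun=> s) (F \o g)); last exact: cF.
    exact: cst_continuous.
  move=> t e tab e0; have [dHt HtE] := dH t tab.
  have := potential_derivative e0 (dg t tab) dHt HtE.
  apply: filterS => h; apply: le_trans.
  rewrite [leLHS](_ : _ = s * (F (g (t + h)) - F (g t)) - (H (t + h) - H t)); last by ring.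
  by rewrite lerD2r (le_trans (ler_norm _)) // normrM s1 mul1r.
have := key 1 (normr1 _); have := key (-1) (normrN1 _).
rewrite Ha subr0 !mulN1r !mul1r ler_norml; lra.
Qed.

End Piece.
End Length.

(** * Paths cut at their breakpoints *)

Section PathLength.
Context (R : realType).
Local Notation mu := (@lebesgue_measure R).

(** Neighbouring closed pieces share a breakpoint, so the tail is made half-open before the
    integrals are added and closed again at no cost. *)
Lemma integral_pieces (f : R -> R) (s : seq R) (a : R) : (forall t, 0 <= f t) ->
  path <%R a s ->
  (forall i, (i < size s)%N -> measurable_fun `[nth 0 (a :: s) i, nth 0 s i] f) ->
  measurable_fun `[a, last a s] f /\
  (\int[mu]_(t in `[a, last a s]) (f t)%:E =
   \sum_(i < size s) \int[mu]_(t in `[nth 0%R (a :: s) i, nth 0%R s i]) (f t)%:E)%E.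
Proof.
move=> f0; elim: s a => [|b s IH] a /=.
  move=> _ _; rewrite set_itv1; split; first exact: measurable_fun_set1.
  by rewrite integral_set1 big_ord0.
move=> /andP[ab bs] mf.
have [ms Is] := IH b bs (fun i => mf i.+1).
have mab : measurable_fun `[a, b] f by exact: (mf 0%N).
have bl : b <= last b s.
  by move: bs => /(order_path_min lt_trans) /allP h; have := mem_last b s;
    rewrite inE => /predU1P[->|/h /ltW].
have U : (`[a, last b s] = `[a, b] `|` `]b, last b s])%classic.
  by apply: itv_bndbnd_setU; rewrite bnd_simp // ltW.
have mo : measurable_fun `]b, last b s] f.
  by apply: measurable_funS ms => // t /=; rewrite !in_itv /= => /andP[/ltW -> ->].
have mU : measurable_fun (`[a, b] `|` `]b, last b s]) f.
  by apply/measurable_funU.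
split; first by rewrite U.
rewrite U ge0_integral_setU //=.
- rewrite big_ord_recl /= -Is; congr (_ + _)%E.
  by rewrite integral_itv_obnd_cbnd //; exact/measurable_EFinP.
- exact/measurable_EFinP.
- by move=> t _; rewrite lee_fin.
- apply/disj_setPS => t /=; rewrite !in_itv /= => -[/andP[_ tb] /andP[bt _]].
  by move: tb; rewrite leNgt bt.
Qed.

Lemma telescope_norm_le (phi : R -> R) (s : seq R) (a : R) (K : nat -> \bar R) :
  (forall i, (i < size s)%N ->
     (`|phi (nth 0%R s i) - phi (nth 0%R (a :: s) i)|%:E <= K i)%E) ->
  (`|phi (last a s) - phi a|%:E <= \sum_(i < size s) K i)%E.
Proof.
elim: s a K => [|b s IH] a K /= H; first by rewrite big_ord0 subrr normr0.
rewrite big_ord_recl; have h0 := H 0%N isT.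
have hs := IH b (fun i => K i.+1) (fun i => H i.+1).
apply: le_trans (leeD h0 hs); rewrite -EFinD lee_fin [leRHS]addrC.
by rewrite (le_trans _ (ler_normD _ _)) // addrA subrK.
Qed.

Section Paths.
Variables (d : nat) (P : {fset 'rV[R]_d}).
Hypothesis P0 : P != fset0.

(** The derivative of [g] is known to be [v] only inside the interval; the two ends form a null
    set. *)
Lemma C1_piece_integral (a b : R) (g v : R -> 'rV[R]_d) :
  {within `[a, b], continuous g} -> {within `[a, b], continuous v} ->
  (forall t, t \in `]a, b[ -> is_derive t 1 g (v t)) ->
  measurable_fun `[a, b] (speed P g (derive1 g)) /\
  (\int[mu]_(t in `[a, b]) (speed P g (derive1 g) t)%:E =
   \int[mu]_(t in `[a, b]) (speed P g v t)%:E)%E.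
Proof.
move=> cg cv dg.
have E : {in `]a, b[, speed P g (derive1 g) =1 speed P g v}.
  by move=> t /dg [_ gE]; rewrite /speed derive1E gE.
have mv : measurable_fun `]a, b[ (speed P g v).
  apply: subspace_continuous_measurable_fun => //.
  apply: continuous_subspaceW (speed_within P0 cg cv).
  by move=> t /=; rewrite !in_itv /= => /andP[/ltW -> /ltW ->].
have mg : measurable_fun `]a, b[ (speed P g (derive1 g)).
  by apply: eq_measurable_fun mv => t; rewrite inE /= => /E ->.
split; first exact: measurable_fun_itv_cc mg.
exact: eq_integral_itv_bounded.
Qed.

Lemma nn_lengthE (g : R -> 'rV[R]_d) (s : seq R) : itv_partition 0 1 s ->
  (forall i, (i < size s)%N -> C1_on (nth 0 (0 :: s) i) (nth 0 s i) g) ->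
  (nn_length P g = \sum_(i < size s)
    \int[mu]_(t in `[nth 0%R (0%R :: s) i, nth 0%R s i]) (speed P g (derive1 g) t)%:E)%E.
Proof.
move=> [ps /eqP ls] C1.
have [|i ilt|_ <-] := @integral_pieces (speed P g (derive1 g)) s 0 _ ps.
- by move=> t; exact: speed_ge0.
- have [cg [v cv dg]] := C1 i ilt.
  by have [] := C1_piece_integral cg cv dg.
- by rewrite ls.
Qed.

(** Applied to the function from [potential], this is the lower bound for the metric:
    [potential_piece] on each piece, then the triangle inequality. *)
Lemma nn_metric_ge (F : 'rV[R]_d -> R) x y :
  (forall x y, `|F x - F y| <= 4 * (nn_dist P x + 2 * enorm (x - y)) * enorm (x - y)) ->
  (`|F y - F x|%:E <= nn_metric P x y)%E.
Proof.
move=> Flip; apply: le_ereal_inf_tmp => _ [g [cg g0 g1 [s sP C1]] <-].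
rewrite (nn_lengthE sP C1) -g0 -g1; have [ps /eqP ls] := sP.
have -> : F (g 1) = (F \o g) (last 0 s) by rewrite ls.
apply: (@telescope_norm_le (F \o g) s 0 (fun i =>
  \int[mu]_(t in `[nth 0%R (0%R :: s) i, nth 0%R s i]) (speed P g (derive1 g) t)%:E)%E) => i
    ilt.
have [cgi [v cv dg]] := C1 i ilt.
have [_ ->] := C1_piece_integral cgi cv dg.
apply: potential_piece => //.
by move/(pathP 0) : ps; apply.
Qed.

End Paths.
End PathLength.

(** * Polygonal paths *)

Section Polygon.
Context (R : realType).
Local Notation mu := (@lebesgue_measure R).

(* Projection of the real line onto [0, 1]. *)
Definition clamp (u : R) : R := (`|u| - `|u - 1| + 1) / 2.

Lemma clamp0 u : u <= 0 -> clamp u = 0.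
Proof. by move=> u0; rewrite /clamp !ler0_norm; lra. Qed.

Lemma clamp1 u : 1 <= u -> clamp u = 1.
Proof. by move=> u0; rewrite /clamp !ger0_norm; lra. Qed.

Lemma clamp_id u : 0 <= u <= 1 -> clamp u = u.
Proof. by move=> u0; rewrite /clamp ger0_norm ?ler0_norm; lra. Qed.

Lemma clamp_continuous : continuous clamp.
Proof.
move=> u; apply: (@continuousM _ R (fun u => `|u| - `|u - 1| + 1) (fun=> 2^-1));
  last exact: cst_continuous.
apply: (@continuousD _ R R (fun u => `|u| - `|u - 1|) (fun=> 1)); last exact: cst_continuous.
apply: (@continuousB _ R R (fun u => `|u|) (fun u => `|u - 1|)); first exact: norm_continuous.
apply: (@continuous_comp _ _ _ (fun u : R => u - 1)); last exact: norm_continuous.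
by apply: continuousB; [exact: cvg_id | exact: cst_continuous].
Qed.

Lemma is_derive_line d (c w : 'rV[R]_d) (t : R) :
  is_derive t 1 (fun s : R => c + s *: w) w.
Proof.
have lim_w : (h : R)^-1 *: ((c + (h *: 1 + t) *: w) - (c + t *: w)) @[h --> 0^'] --> w.
  apply: cvg_near_cst; near=> h.
  have h0 : h != 0 by near: h; exact: nbhs_dnbhs_neq.
  rewrite opprD addrACA subrr add0r -scalerBl addrK scalerA.
  by rewrite [h *: 1]mulr1 mulVf // scale1r.
apply: DeriveDef; first by apply/cvg_ex; exists w.
exact: (cvg_lim (@norm_hausdorff _ _) lim_w).
Unshelve. all: by end_near. Qed.

Section Path.
Variables (d : nat) (P : {fset 'rV[R]_d}).
Hypothesis P0 : P != fset0.

(** The cost [c] is the length of the segment when [p] stands in for the nearest point: at parameter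
    [l] the distance to [p] is [l * enorm w], and [4 * l * dot w w] is integrated between [l1] and
    [l2]. *)
Definition on_ray (x y : 'rV[R]_d) (c : R) :=
  exists p w l1 l2, [/\ p \in P, 0 <= l1 /\ 0 <= l2, x = p + l1 *: w,
    y = p + l2 *: w & c = 2 * `|l2 ^+ 2 - l1 ^+ 2| * dot w w].

Variables (n : nat) (y : nat -> 'rV[R]_d) (c : nat -> R).
Hypothesis n0 : (0 < n)%N.
Hypothesis yc : forall i, (i < n)%N -> on_ray (y i) (y i.+1) (c i).

(** One formula on the whole line makes continuity immediate: during the [k]-th of [n] equal time
    intervals the earlier increments are complete and the later ones have not begun. *)
Definition polygon (t : R) : 'rV[R]_d :=
  y 0 + \sum_(i < n) clamp (n%:R * t - i%:R) *: (y i.+1 - y i).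

Lemma polygonE k (t : R) : (k < n)%N -> k%:R <= n%:R * t <= k.+1%:R ->
  polygon t = y k + (n%:R * t - k%:R) *: (y k.+1 - y k).
Proof.
move=> kn /andP[kt tk]; rewrite /polygon.
pose S m := \sum_(i < m) clamp (n%:R * t - i%:R) *: (y i.+1 - y i).
have S1 m : (m <= k)%N -> S m = y m - y 0.
  elim: m => [|m IH] mk; first by rewrite /S big_ord0 subrr.
  rewrite /S big_ord_recr /= -/(S m) IH ?clamp1 ?scale1r; last exact: ltnW.
    by rewrite addrC addrA subrK.
  have : (m.+1%:R : R) <= k%:R by rewrite ler_nat.
  by rewrite -natr1; lra.
have S2 : S k.+1 = y k - y 0 + (n%:R * t - k%:R) *: (y k.+1 - y k).
  rewrite /S big_ord_recr /= -/(S k) S1 // clamp_id //.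
  by move: tk; rewrite -natr1; lra.
have S3 m : S (k.+1 + m)%N = S k.+1.
  elim: m => [|m IH]; first by rewrite addn0.
  rewrite addnS /S big_ord_recr /= -/(S (k.+1 + m)%N) IH clamp0 ?scale0r ?addr0 //.
  by rewrite natrD; have := ler0n R m; move: tk; lra.
have Sn : S n = S k.+1 by rewrite -(S3 (n - k.+1)%N) subnKC.
by rewrite -/(S n) Sn S2 addrA [y 0%N + _]addrC subrK.
Qed.

Lemma polygon_continuous : continuous polygon.
Proof.
move=> t; apply: (@continuousD _ _ R (fun=> y 0)
  (fun t => \sum_(i < n) clamp (n%:R * t - i%:R) *: (y i.+1 - y i))).
  exact: cst_continuous.
apply: cvg_big => [|i _]; first exact: add_continuous.
apply: cvgZr_tmp.
apply: (@continuous_comp _ _ _ (fun t : R => n%:R * t - i%:R)); last exact: clamp_continuous.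
apply: (@continuousB _ R R (fun t => n%:R * t) (fun=> i%:R)); last exact: cst_continuous.
by apply: (@continuousM _ R (fun=> n%:R) id); [exact: cst_continuous | exact: cvg_id].
Qed.

Let nR0 : (0 : R) < n%:R. Proof. by rewrite ltr0n. Qed.

Definition grid : seq R := mkseq (fun i => i.+1%:R / n%:R) n.

Lemma grid_nthS i : (i < n)%N -> nth 0 grid i = i.+1%:R / n%:R.
Proof. by move=> ilt; rewrite nth_mkseq. Qed.

Lemma grid_nth i : (i <= n)%N -> nth 0 (0 :: grid) i = i%:R / n%:R.
Proof. by case: i => [|i] ilt; rewrite ?mul0r //= grid_nthS. Qed.

Lemma grid_partition : itv_partition 0 1 grid.
Proof.
split.
  apply/(pathP 0) => i; rewrite size_mkseq => ilt.
  rewrite grid_nthS // grid_nth; last exact: ltnW.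
  by rewrite ltr_pM2r ?invr_gt0 // ltr_nat.
by rewrite (last_nth 0) size_mkseq grid_nth // divff // gt_eqF.
Qed.

Lemma polygon_derive i (t : R) : (i < n)%N -> t \in `](i%:R / n%:R), (i.+1%:R / n%:R)[ ->
  is_derive t 1 polygon (n%:R *: (y i.+1 - y i)).
Proof.
rewrite in_itv /= => ilt /andP[it ti].
apply: near_eq_is_derive (is_derive_line (y i - i%:R *: (y i.+1 - y i)) _ _).
near=> s.
have si : i%:R / n%:R < s by near: s; exact: lt_nbhsr.
have ti' : s < i.+1%:R / n%:R by near: s; exact: lt_nbhsl.
rewrite (@polygonE i) //; first by rewrite scalerBl -addrA [- _ + _]addrC mulrC scalerA.
by apply/andP; split; apply: ltW; [rewrite mulrC -ltr_pdivrMr | rewrite mulrC -ltr_pdivlMr].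
Unshelve. all: by end_near. Qed.

(** Bounding the distance to [P] by the distance to the origin [p] of the ray turns the integrand
    into a polynomial, which is integrated exactly. *)
Lemma polygon_piece i : (i < n)%N ->
  (\int[mu]_(t in `[(i%:R / n%:R)%R, (i.+1%:R / n%:R)%R])
     (speed P polygon (fun=> n%:R *: (y i.+1 - y i)) t)%:E <= (c i)%:E)%E.
Proof.
move=> ilt; have [p [w [l1 [l2 [pP [l10 l20] yi yi1 ->]]]]] := yc ilt.
pose a : R := i%:R / n%:R; pose b : R := i.+1%:R / n%:R; rewrite -/a -/b.
have ab : a < b by rewrite ltr_pM2r ?invr_gt0 // ltr_nat.
have na : n%:R * a = i%:R by rewrite mulrC divfK // gt_eqF.
have nb : n%:R * b = i%:R + 1 by rewrite natr1 mulrC divfK // gt_eqF.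
pose dl := l2 - l1.
(* [L] is the ray parameter at time [t], and [G] an antiderivative of [4 * dot w w * L] times the
   absolute value of the slope of [L], which explains the sign of [dl]. *)
pose L : {poly R} := (l1 - i%:R * dl)%:P + (n%:R * dl)%:P * 'X.
pose G : {poly R} := (2 * Num.sg dl * dot w w)%:P * (L * L).
have LE t : L.[t] = l1 + (n%:R * t - i%:R) * dl.
  by rewrite /L !hornerE; ring.
have GE t : G.[t] = 2 * Num.sg dl * dot w w * L.[t] ^+ 2.
  by rewrite /G hornerM hornerC hornerM -expr2.
have dGE t : (deriv G).[t] = 4 * (`|dl| * n%:R) * dot w w * L.[t].
  by rewrite normrEsg LE /G /L !(derivM, derivD, derivC, derivX) !(hornerM, hornerD, hornerC,
    hornerX); ring.
have step : y i.+1 - y i = dl *: w.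
  by rewrite yi yi1 opprD addrACA subrr add0r -scalerBl.
have le t : t \in `[a, b] ->
    speed P polygon (fun=> n%:R *: (y i.+1 - y i)) t <= (deriv G).[t].
  rewrite in_itv /= => /andP[at0 tb].
  have t1 : i%:R <= n%:R * t by rewrite -na ler_pM2l.
  have t2 : n%:R * t <= i%:R + 1 by rewrite -nb ler_pM2l.
  have L0 : 0 <= L.[t].
    have -> : L.[t] = l1 * (i%:R + 1 - n%:R * t) + l2 * (n%:R * t - i%:R).
      by rewrite LE /dl; ring.
    by rewrite addr_ge0 // mulr_ge0 // subr_ge0.
  have gE : polygon t = p + L.[t] *: w.
    rewrite (@polygonE i) // ?natr1 ?t1 //; last by rewrite -natr1.
    by rewrite step {1}yi LE scalerA -addrA -scalerDl.
  rewrite /speed dGE step enormZ (ger0_norm (ltW nR0)) enormZ -enorm_sqr.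
  have := nn_dist_le (polygon t) pP.
  rewrite gE opprD addrA subrr add0r enormN enormZ (ger0_norm L0) => nnle.
  have -> : 4 * (`|dl| * n%:R) * enorm w ^+ 2 * L.[t] =
            4 * (L.[t] * enorm w) * (n%:R * (`|dl| * enorm w)) by ring.
  apply: ler_wpM2r; last by rewrite ler_pM2l.
  by rewrite !mulr_ge0 ?enorm_ge0 // ltW.
have contG q : {within `[a, b], continuous (horner (q : {poly R}))}.
  by apply: continuous_subspaceT => x; exact: continuous_horner.
have iG : (\int[mu]_(t in `[a, b]) ((deriv G).[t])%:E = (G.[b])%:E - (G.[a])%:E)%E.
  apply: continuous_FTC2 => //.
    split.
    - by move=> x _; exact: (ex_derive (is_derive := is_derive_poly G x)).
    - by apply: cvg_at_right_filter; exact: continuous_horner.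
    - by apply: cvg_at_left_filter; exact: continuous_horner.
  by move=> x _; rewrite derive1E derive_val.
apply: (@le_trans _ _ (\int[mu]_(t in `[a, b]) ((deriv G).[t])%:E)%E).
  apply: ge0_le_integral => //.
  - by move=> t _; rewrite lee_fin; exact: speed_ge0.
  - apply/measurable_EFinP; apply: subspace_continuous_measurable_fun => //.
    apply: speed_within => //.
      by apply: continuous_subspaceT; exact: polygon_continuous.
    by apply: continuous_subspaceT => x; exact: cst_continuous.
  - apply/measurable_EFinP; apply: subspace_continuous_measurable_fun => //.
    exact: (contG (deriv G)).
rewrite iG -EFinB lee_fin !GE !LE na nb subrr mul0r addr0.
have -> : l1 + (i%:R + 1 - i%:R) * dl = l2 by rewrite /dl; ring.
have -> : 2 * Num.sg dl * dot w w * l2 ^+ 2 - 2 * Num.sg dl * dot w w * l1 ^+ 2 =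
  2 * (Num.sg dl * (l2 ^+ 2 - l1 ^+ 2)) * dot w w by ring.
rewrite ler_wpM2r ?dot_ge0 // ler_pM2l // (le_trans (ler_norm _)) // normrM normr_sg.
by rewrite ler_piMl //; case: eqP.
Qed.

Lemma nn_metric_polygon : (nn_metric P (y 0) (y n) <= (\sum_(i < n) c i)%:E)%E.
Proof.
have C1 i : (i < size grid)%N -> C1_on (nth 0 (0 :: grid) i) (nth 0 grid i) polygon.
  rewrite size_mkseq => ilt; rewrite grid_nthS // grid_nth ?(ltnW ilt) //; split.
    by apply: continuous_subspaceT; exact: polygon_continuous.
  exists (fun=> n%:R *: (y i.+1 - y i)).
    by apply: continuous_subspaceT => x; exact: cst_continuous.
  by move=> t; exact: polygon_derive.
apply: (@le_trans _ _ (nn_length P polygon)).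
  apply: ereal_inf_lbound; exists polygon => //; split.
  - by apply: continuous_subspaceT; exact: polygon_continuous.
  - by rewrite (@polygonE 0) // ?mulr0 ?subrr ?scale0r ?addr0 // lexx ler01.
  - have nE := prednK n0; rewrite (@polygonE n.-1) ?nE //; last first.
      by rewrite mulr1 lexx ler_nat leq_pred.
    have -> : n%:R * 1 - n.-1%:R = 1 :> R.
      by rewrite mulr1 -[in n%:R]nE -natr1 addrAC subrr add0r.
    by rewrite scale1r addrC subrK.
  - by exists grid => //; exact: grid_partition.
rewrite (nn_lengthE P0 grid_partition C1) size_mkseq -sumEFin.
apply: lee_sum => i _; have ilt := ltn_ord i.
rewrite grid_nthS // grid_nth ?(ltnW ilt) //.
have [|||_ ->] := @C1_piece_integral R d P P0 (i%:R / n%:R) (i.+1%:R / n%:R) polygon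
  (fun=> n%:R *: (y i.+1 - y i)).
- by apply: continuous_subspaceT; exact: polygon_continuous.
- by apply: continuous_subspaceT => x; exact: cst_continuous.
- by move=> t; exact: polygon_derive.
exact: polygon_piece.
Qed.

End Path.
End Polygon.

(** * Thresholds *)

Section ShortestPaths.
Context (R : realType).
Variables (w : nat -> nat -> R) (n : nat).
Hypothesis w0 : forall i j, 0 <= w i j.

Lemma fw_le k i j : fw w k i j <= w i j.
Proof. by elim: k => //= k; apply: le_trans; rewrite ge_min lexx orbT. Qed.

Lemma fw_triangle k l i j : (l < k)%N -> fw w k i j <= fw w k i l + fw w k l j.
Proof.
elim: k l i j => // k IH l i j; rewrite ltnS leq_eqVlt => /predU1P[->|lk] /=.
  have := fw_nonneg w0 k k k; have := fw_nonneg w0 k i k; have := fw_nonneg w0 k k j.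
  by rewrite !minEle; do ![case: ifP]; lra.
have := IH l i j lk; have := IH l i k lk; have := IH l k j lk; have := IH l k k lk.
have := fw_nonneg w0 k k l; have := fw_nonneg w0 k l k.
by rewrite !minEle; do ![case: ifP]; lra.
Qed.

Fixpoint walk_cost (i : nat) (l : seq nat) : R :=
  if l is j :: l' then w i j + walk_cost j l' else 0.

Lemma walk_cost_cat i l l' :
  walk_cost i (l ++ l') = walk_cost i l + walk_cost (last i l) l'.
Proof. by elim: l i => [|j l IH] i /=; rewrite ?add0r // IH addrA. Qed.

(** The walk is kept nonempty, even from a vertex to itself, because a [ray_path] has at least one
    leg. *)
Lemma fw_walk k i j : (k <= n)%N -> (i < n)%N -> (j < n)%N ->
  exists l, [/\ l != [::], all (fun a => a < n)%N l, last i l = j &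
    walk_cost i l = fw w k i j].
Proof.
elim: k i j => [|k IH] i j kn iln jln /=.
  by exists [:: j]; rewrite /= jln addr0.
rewrite minEle; case: ifP => _; last exact: IH (ltnW kn) _ _.
have [l [l0 ln li lc]] := IH i k (ltnW kn) iln kn.
have [l' [l0' ln' li' lc']] := IH k j (ltnW kn) kn jln.
exists (l ++ l'); rewrite all_cat ln ln' last_cat li li' walk_cost_cat li lc lc'.
by split=> //; case: l l0 {ln li lc}.
Qed.

End ShortestPaths.

(** The weights read from memory are squared distances only for indices below [n]; the recursion
    meets no others. *)
Lemma fw_ext (R : realType) (w w' : nat -> nat -> R) n k i j :
  (forall a b, (a < n)%N -> (b < n)%N -> w a b = w' a b) ->
  (k <= n)%N -> (i < n)%N -> (j < n)%N -> fw w k i j = fw w' k i j.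
Proof.
move=> ww; elim: k i j => [|k IH] i j kn iln jln /=; first exact: ww.
by rewrite !IH // ltnW.
Qed.

(** * Paths along rays from the input points *)

Section RayPaths.
Context (R : realType).
Variables (d : nat) (P : {fset 'rV[R]_d}).

Inductive ray_path : 'rV[R]_d -> 'rV[R]_d -> R -> Prop :=
| ray_one x y c : on_ray P x y c -> ray_path x y c
| ray_step x y z c c' : on_ray P x y c -> ray_path y z c' -> ray_path x z (c + c').

Lemma ray_path_trans x y z c c' :
  ray_path x y c -> ray_path y z c' -> ray_path x z (c + c').
Proof.
move=> H; elim: H z c' => [x1 y1 c1 h|x1 y1 z1 c1 c2 h _ IH] z c' h'.
  exact: ray_step h h'.
by rewrite -addrA; apply: ray_step h _; exact: IH.
Qed.

Lemma nn_metric_ray_path x y c : ray_path x y c -> (nn_metric P x y <= c%:E)%E.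
Proof.
move=> H.
have [p pP] : exists p, p \in P by case: H => [? ? ? [p [? [? [? []]]]]|? ? ? ? ? [p [? [? [?
  []]]]]]; exists p.
have P0 : P != fset0 by apply/fset0Pn; exists p.
suff [n [v [k [n0 vk <- <- <-]]]] : exists n v (k : nat -> R), [/\ (0 < n)%N,
    forall i, (i < n)%N -> on_ray P (v i) (v i.+1) (k i), v 0%N = x, v n = y &
    \sum_(i < n) k i = c].
  exact: nn_metric_polygon.
elim: H => [{}x {}y {}c h|{}x {}y z {}c c' h _ [n [v [k [n0 vk v0 vn kc]]]]].
  exists 1%N, (fun i => if i is 0%N then x else y), (fun=> c); split=> //.
    by case.
  by rewrite big_ord1.
exists n.+1, (fun i => if i is j.+1 then v j else x), (fun i => if i is j.+1 then k j else c).
split=> //; last by rewrite big_ord_recl /= -kc.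
by case=> [|i] ilt /=; [rewrite v0 | exact: vk].
Qed.

Lemma dot_opp (x y : 'rV[R]_d) : dot (x - y) (x - y) = dot (y - x) (y - x).
Proof. by rewrite -!enorm_sqr enormB. Qed.

(** Cut at the midpoint, each half lies on a ray from its own endpoint up to parameter 1/2, so it
    costs [2 * (1/2)^2] times the squared length. *)
Lemma half_edge p q (h := p + 2^-1 *: (q - p)) : p \in P -> q \in P ->
  on_ray P p h (2^-1 * dot (q - p) (q - p)) /\ on_ray P h q (2^-1 * dot (q - p) (q - p)).
Proof.
move=> pP qP; have h0 : 0 <= 2^-1 :> R by rewrite invr_ge0.
split.
  exists p, (q - p), 0, 2^-1; split=> //; rewrite ?scale0r ?addr0 //.
  by rewrite (expr0n R 2) subr0 ger0_norm ?sqr_ge0 //; field.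
exists q, (p - q), 2^-1, 0; split=> //; rewrite ?scale0r ?addr0 //.
  by apply/rowP => i; rewrite !mxE; field.
by rewrite (expr0n R 2) sub0r normrN ger0_norm ?sqr_ge0 // dot_opp; field.
Qed.

Lemma edge_path p q : p \in P -> q \in P -> ray_path p q (dot (q - p) (q - p)).
Proof.
move=> pP qP; have [h1 h2] := half_edge pP qP.
have -> : dot (q - p) (q - p) = 2^-1 * dot (q - p) (q - p) + 2^-1 * dot (q - p) (q - p).
  by field.
by apply: ray_step h1 _; exact: ray_one.
Qed.

Lemma edge_point p q t : p \in P -> q \in P -> 0 <= t <= dot (q - p) (q - p) ->
  exists x, ray_path x p t /\ ray_path x q (dot (q - p) (q - p) - t).
Proof.
wlog: p q t / t <= 2^-1 * dot (q - p) (q - p) => [H|th] pP qP t01.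
  have [th|th] := leP t (2^-1 * dot (q - p) (q - p)); first exact: H.
  have [||||x [h1 h2]] := H q p (dot (q - p) (q - p) - t); rewrite ?(dot_opp p q) //.
  - lra.
  - lra.
  by exists x; split=> //; move: h2; rewrite (dot_opp p q) subKr.
have /andP[t0 _] := t01; set L := dot (q - p) (q - p) in th t01 *.
(* On the first half of the edge, reaching parameter [l] from [p] costs [2 * l ^+ 2 * L]; this is
   solved for cost [t]. If [L = 0] then [t = 0], and division by zero gives [l = 0]. *)
pose l := Num.sqrt (t / (2 * L)).
have L0 : 0 <= L by exact: dot_ge0.
have l0 : 0 <= l by exact: sqrtr_ge0.
have lL : 2 * l ^+ 2 * L = t.
  rewrite /l sqr_sqrtr ?divr_ge0 ?mulr_ge0 //.
  have [LE|LE] := eqVneq L 0; last by field.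
  by rewrite LE !mulr0; move: th; rewrite LE; lra.
have ll : l ^+ 2 <= 2^-1 ^+ 2.
  rewrite /l sqr_sqrtr ?divr_ge0 ?mulr_ge0 //.
  have [LE|LE] := eqVneq L 0; first by rewrite LE mulr0 invr0 mulr0 sqr_ge0.
  by rewrite ler_pdivrMr ?mulr_gt0 ?lt_neqAle 1?eq_sym ?LE //; lra.
have [_ h2] := half_edge pP qP.
exists (p + l *: (q - p)); split.
  apply: ray_one; exists p, (q - p), l, 0; split; rewrite ?scale0r ?addr0 //.
  by rewrite expr0n sub0r normrN ger0_norm ?sqr_ge0.
have -> : L - t = (2^-1 * L - t) + 2^-1 * L by field.
apply: ray_step; last exact: ray_one h2.
exists p, (q - p), l, 2^-1; split=> //.
by rewrite ger0_norm ?subr_ge0 // -/L -lL; field.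
Qed.

Variable pt : nat -> 'rV[R]_d.
Local Notation w := (fun i j => dot (pt j - pt i) (pt j - pt i)).

Lemma walk_path i l : l != [::] -> pt i \in P -> all (fun a => pt a \in P) l ->
  ray_path (pt i) (pt (last i l)) (walk_cost w i l).
Proof.
elim: l i => // j l IH i _ iP /= /andP[jP lP].
have e := edge_path iP jP; have [->|l0] := eqVneq l [::]; first by rewrite /= addr0.
exact: ray_path_trans e (IH j l0 jP lP).
Qed.

(** The budget [t] is spent edge by edge; the edge on which it runs out contains the point. *)
Lemma walk_point i l t : l != [::] -> pt i \in P -> all (fun a => pt a \in P) l ->
  0 <= t <= walk_cost w i l ->
  exists x, ray_path x (pt i) t /\ ray_path x (pt (last i l)) (walk_cost w i l - t).
Proof.
elim: l i t => // j l IH i t _ iP /= /andP[jP lP] t01; have /andP[t0 t1] := t01.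
have [tw|tw] := leP t (w i j).
  have [|x [h1 h2]] := edge_point (t := t) iP jP; first by rewrite t0.
  exists x; split=> //; have [->|l0] := eqVneq l [::]; first by rewrite /= addr0.
  by rewrite addrAC; apply: ray_path_trans h2 _; exact: walk_path.
have l0 : l != [::] by apply/eqP => l0; move: t1 tw; rewrite l0 /= addr0; lra.
have [|x [h1 h2]] := IH j (t - w i j) l0 jP lP; first by lra.
exists x; split.
  rewrite -(subrK (w i j) t); apply: ray_path_trans h1 _.
  by rewrite [X in ray_path _ _ X]dot_opp; exact: edge_path.
by rewrite [X in ray_path _ _ X](_ : _ = walk_cost w j l - (t - w i j)) //; ring.
Qed.

End RayPaths.

(** * The scale at which an edge enters *)

Section Threshold.
Context (R : realType).
Variables (d : nat) (P : {fset 'rV[R]_d}) (s : seq 'rV[R]_d).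
Hypotheses (us : uniq s) (sP : s =i P).
Local Notation n := (size s).
Local Notation pt i := (nth 0 s i).
Local Notation w := (fun i j => dot (pt j - pt i) (pt j - pt i)).

Lemma cech_edge_threshold i j alpha : (i < j < n)%N ->
  cech_edges (nn_metric P) P alpha [fset pt i; pt j]%fset <->
  fw w n i j / 2 <= alpha.
Proof.
move=> /andP[ij jn]; have iln := ltn_trans ij jn.
have ptP k : (k < n)%N -> pt k \in P by move=> kn; rewrite -sP mem_nth.
have w0 k l : 0 <= w k l by exact: dot_ge0.
have P0 : P != fset0 by apply/fset0Pn; exists (pt i); exact: ptP.
have in2 q : q \in [fset pt i; pt j]%fset -> q = pt i \/ q = pt j.
  by rewrite !inE => /orP[] /eqP ->; [left|right].
split.
  move=> [[_ _ [x xb]] _].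
  (* The edge-squared distance from the [i]-th point; [flip] follows from the triangle inequality
     and the cost of a single edge. *)
  pose f p := fw w n i (index p s).
  have flip p q : p \in P -> q \in P -> `|f p - f q| <= enorm (p - q) ^+ 2.
    rewrite -!sP => ps qs; rewrite enorm_sqr.
    have tr a b : a \in s -> b \in s -> f a <= f b + dot (a - b) (a - b).
      move=> as_ bs; have bn : (index b s < n)%N by rewrite index_mem.
      apply: le_trans (fw_triangle w0 i (index a s) bn) _.
      by rewrite lerD2l (le_trans (fw_le _ _ _ _)) // !nth_index.
    have := tr p q ps qs; have := tr q p qs ps; rewrite (dot_opp q p).
    by rewrite ler_norml; lra.
  have [F [Fa Fb Flip]] := potential (ptP i iln) flip.
  have b1 : (nn_metric P x (pt i) <= alpha%:E)%E by apply: xb; rewrite /= !inE eqxx.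
  have b2 : (nn_metric P x (pt j) <= alpha%:E)%E by apply: xb; rewrite /= !inE eqxx orbT.
  (* From [x] to either centre the potential changes by at most [alpha], hence by at most
     [2 * alpha] between the centres. *)
  have := le_trans (nn_metric_ge P0 x (pt i) Flip) b1.
  have := le_trans (nn_metric_ge P0 x (pt j) Flip) b2.
  have := Fb (pt j) (ptP j jn); rewrite /f !index_uniq // Fa !lee_fin !ler_norml.
  (* The diagonal value [f (pt i)] is at most 0, so [F (pt j)] is at least the whole distance
     between the centres. *)
  have := fw_le w n i i; rewrite subrr /dot big1; last by move=> k _; rewrite mxE mulr0.
  lra.
move=> Da; have [l [l0 ln li lc]] := @fw_walk R w n n i j (leqnn n) iln jn.
have D0 := fw_nonneg w0 n i j.
have [||x [h1 h2]] := @walk_point R d P (fun k => pt k) i l (fw w n i j / 2) l0 (ptP i iln).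
- by apply/allP => k kl; apply: ptP; move/allP : ln; apply.
- by rewrite lc; lra.
have ij' : pt i != pt j by rewrite nth_uniq // neq_ltn ij.
split; last by rewrite cardfs2 ij'.
split.
- by apply/fset0Pn; exists (pt i); rewrite !inE eqxx.
- by apply/fsubsetP => q /in2[] ->; exact: ptP.
exists x => q /= /in2[] ->.
  by apply: le_trans (nn_metric_ray_path h1) _; rewrite lee_fin.
move: h2; rewrite li lc => h2.
by apply: le_trans (nn_metric_ray_path h2) _; rewrite lee_fin; move: Da; lra.
Qed.

Lemma input_cell i (k : 'I_d) : (i < n)%N ->
  memory (input_state s) (i * d + k)%N = pt i 0 k.
Proof.
rewrite /=; elim: s i => // p s' IH [|i] /= ilt.
  rewrite mul0n add0n nth_cat size_map size_enum_ord ltn_ord.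
  by rewrite (nth_map k) ?size_enum_ord // nth_ord_enum.
rewrite nth_cat size_map size_enum_ord mulSn -addnA ltnNge leq_addr /= addKn.
exact: IH.
Qed.

End Threshold.

Theorem theorem4p1 (R : realType) :
  exists (c : program) (q : {poly nat}),
    forall (d : nat) (P : {fset 'rV[R]_d}) (s : seq 'rV[R]_d),
      uniq s -> s =i P ->
      exists (T : nat) (st : state R),
        [/\ exec c (input_state s) T st,
            (T <= q.[(size s + d)%N])%N &
            encodes_cech_edges (nn_metric P) P s st].
Proof.
exists prog_edges, (100%:P * ('X + 1%:P) ^+ 4) => d P s us sP.
have [T [st [ex le Q]]] := runs_edges (st0 := input_state s)
  (x := fun i k => memory (input_state s) (i * d + k)%N)
  (erefl (size s)) (erefl d) erefl (fun _ _ _ _ => erefl).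
exists T, st; split=> //.
  by rewrite hornerM horner_exp hornerD !hornerC hornerX; move: le; rewrite -[(_ + d).+1]addn1.
move=> i j /[dup] ijn /andP[ij jn] alpha _; have iln := ltn_trans ij jn.
rewrite Q // (@fw_ext R _ (fun i j => dot (nth 0 s j - nth 0 s i) (nth 0 s j - nth 0 s i))
  (size s)) //; last first.
  move=> a b an bn; rewrite /dot; apply: eq_bigr => k _.
  by rewrite !input_cell // !mxE -expr2 -sqrrN opprB.
exact: cech_edge_threshold.
Qed.
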